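(* Let $\mathcal{C}$ be a unitary fusion category equipped with a braiding $c$. Then $\mathcal{C}$ admits a unique unitary ribbon structure; that is, there exists exactly one natural automorphism $\theta$ of the identity functor of $\mathcal{C}$ that is a unitary ribbon structure with respect to $c$.
   Context: Fusion categories are over $\mathbb{C}$: semisimple rigid $\mathbb{C}$-linear abelian monoidal categories with bilinear tensor product, finitely many isomorphism classes of simple objects, finite-dimensional Hom-spaces, and simple unit object. A braiding is a natural isomorphism $c_{X,Y}:X\otimes Y\to Y\otimes X$ satisfying the hexagon axioms. Associativity and unit constraints are suppressed in formulas. A $C^*$-category is a $\mathbb{C}$-linear abelian category with an involutive antilinear contravariant endofunctor $*$ that is the identity on objects (the image of $f:X\to Y$ is written $f^*:Y\to X$), whose Hom-spaces are Banach spaces with norms satisfying $\|fg\|\le\|f\|\,\|g\|$ for all composable $f,g$ and $\|f^*f\|=\|f\|^2$ for all morphisms $f$, and such that for each $f:X\to Y$ the element $f^*f$ is positive in the $C^*$-algebra $\mathrm{End}(X)$. A morphism $u:X\to Y$ is unitary if $uu^*=\mathrm{id}_Y$ and $u^*u=\mathrm{id}_X$. A unitary fusion category is a fusion category $\mathcal{C}$ whose underlying category is a $C^*$-category, such that the associativity and unit constraints are unitary and $(f\otimes g)^*=f^*\otimes g^*$ for all morphisms $f,g$. Duals: a dual of $X$ is an object $X^\vee$ with morphisms $\mathrm{ev}_X:X^\vee\otimes X\to I$ and $\mathrm{coev}_X:I\to X\otimes X^\vee$ satisfying the zig-zag identities ($I$ is the unit object). The transpose of $f:X\to Y$ is $${}^tf=(\mathrm{ev}_Y\otimes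 \mathrm{id}_{X^\vee})(\mathrm{id}_{Y^\vee}\otimes f\otimes \mathrm{id}_{X^\vee})(\mathrm{id}_{Y^\vee}\otimes\mathrm{coev}_X):Y^\vee\to X^\vee .$$ A twist on a braided fusion category is a natural automorphism $\theta$ of the identity functor such that $\theta_{X\otimes Y}=(\theta_X\otimes\theta_Y)\,c_{Y,X}\,c_{X,Y}$ for all $X,Y$. A twist is a ribbon structure if ${}^t\theta_X=\theta_{X^\vee}$ for all $X$ (this does not depend on the choice of duals). If $\mathcal{C}$ is a unitary fusion category with braiding $c$, a ribbon structure $\theta$ is a unitary ribbon structure if $\theta_X$ is unitary for all $X$ and, for every object $X$, the dual $(X^\vee,\mathrm{ev}_X,\mathrm{coev}_X)$ can be chosen so that $$(\mathrm{coev}_X)^*=\mathrm{ev}_X\,c_{X,X^\vee}\,(\theta_X\otimes\mathrm{id}_{X^\vee}),\qquad (\mathrm{ev}_X)^*=(\mathrm{id}_{X^\vee}\otimes\theta_X^{-1})\,(c_{X^\vee,X})^{-1}\,\mathrm{coev}_X .$$ *)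

(* Defs.v *)
From HB Require Import structures.
From mathcomp Require Import all_boot all_order all_algebra.
From mathcomp Require Import complex.
From mathcomp Require Import all_classical all_reals all_analysis.

Set Implicit Arguments.
Unset Strict Implicit.
Unset Printing Implicit Defensive.

Import Order.TTheory GRing.Theory Num.Theory.
Local Open Scope ring_scope.

(* Hom-spaces are MathComp modules over R[i], with R the real numbers, and
   equality of morphisms is Leibniz equality.  A linear structure is kept apart
   from its family of Hom-spaces so that the latter may also be a family of
   Banach spaces. *)

Record linear_structure (R : realType) (Ob : Type)
    (H : Ob -> Ob -> lmodType R[i]) := LinearStructure {
  ls_id : forall X, H X X;
  ls_comp : forall X Y Z, H Y Z -> H X Y -> H X Z;
  ls_compA : forall X Y Z W (h : H Z W) (g : H Y Z) (f : H X Y),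
    ls_comp h (ls_comp g f) = ls_comp (ls_comp h g) f;
  ls_comp1m : forall X Y (f : H X Y), ls_comp (ls_id Y) f = f;
  ls_compm1 : forall X Y (f : H X Y), ls_comp f (ls_id X) = f;
  ls_comp_linearl : forall X Y Z (a : R[i]) (g g' : H Y Z) (f : H X Y),
    ls_comp (a *: g + g') f = a *: ls_comp g f + ls_comp g' f;
  ls_comp_linearr : forall X Y Z (a : R[i]) (g : H Y Z) (f f' : H X Y),
    ls_comp g (a *: f + f') = a *: ls_comp g f + ls_comp g f'
}.

Record linear_category (R : realType) := LinearCategory {
  ob :> Type;
  Mor : ob -> ob -> lmodType R[i];
  linear_str : linear_structure Mor
}.
Arguments Mor {R} C X Y : rename.

Definition id_mor (R : realType) (C : linear_category R) (X : C) : Mor C X X :=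
  ls_id (linear_str C) X.

Definition mor_comp (R : realType) (C : linear_category R) (X Y Z : C)
    (g : Mor C Y Z) (f : Mor C X Y) : Mor C X Z :=
  ls_comp (linear_str C) g f.

Declare Scope category_scope.
Delimit Scope category_scope with cat.
Local Open Scope category_scope.

Notation "g ∘ f" := (mor_comp g f) (at level 40, left associativity)
  : category_scope.

Section Abelian.
Variables (R : realType) (C : linear_category R).

Definition is_inverse (X Y : C) (f : Mor C X Y) (g : Mor C Y X) : Prop :=
  g ∘ f = id_mor X /\ f ∘ g = id_mor Y.

Definition is_iso (X Y : C) (f : Mor C X Y) : Prop :=
  exists g : Mor C Y X, is_inverse f g.

Definition isomorphic (X Y : C) : Prop := exists f : Mor C X Y, is_iso f.

Definition mono (X Y : C) (f : Mor C X Y) : Prop :=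
  forall W (g h : Mor C W X), f ∘ g = f ∘ h -> g = h.

Definition epi (X Y : C) (f : Mor C X Y) : Prop :=
  forall W (g h : Mor C Y W), g ∘ f = h ∘ f -> g = h.

Definition zero_object (Z : C) : Prop :=
  forall X, (forall f : Mor C X Z, f = 0) /\ (forall f : Mor C Z X, f = 0).

Definition direct_sum (n : nat) (F : 'I_n -> C) (X : C)
    (i : forall k, Mor C (F k) X) (p : forall k, Mor C X (F k)) : Prop :=
  [/\ forall k, p k ∘ i k = id_mor (F k),
      forall k l, k != l -> p k ∘ i l = 0
    & \sum_(k < n) i k ∘ p k = id_mor X].

Definition is_kernel (K X Y : C) (k : Mor C K X) (f : Mor C X Y) : Prop :=
  f ∘ k = 0 /\
  forall W (h : Mor C W X), f ∘ h = 0 -> exists! u : Mor C W K, k ∘ u = h.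

Definition is_cokernel (X Y Q : C) (q : Mor C Y Q) (f : Mor C X Y) : Prop :=
  q ∘ f = 0 /\
  forall W (h : Mor C Y W), h ∘ f = 0 -> exists! u : Mor C Q W, u ∘ q = h.

(* The empty direct sum (n = 0) is a zero object. *)
Record is_abelian : Prop := IsAbelian {
  has_direct_sums : forall n (F : 'I_n -> C),
    exists (X : C) (i : forall k, Mor C (F k) X) (p : forall k, Mor C X (F k)),
      direct_sum i p;
  has_kernels : forall (X Y : C) (f : Mor C X Y),
    exists (K : C) (k : Mor C K X), is_kernel k f;
  has_cokernels : forall (X Y : C) (f : Mor C X Y),
    exists (Q : C) (q : Mor C Y Q), is_cokernel q f;
  mono_normal : forall (X Y : C) (f : Mor C X Y), mono f ->
    exists (Z : C) (g : Mor C Y Z), is_kernel f g;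
  epi_normal : forall (X Y : C) (f : Mor C X Y), epi f ->
    exists (Z : C) (g : Mor C Z X), is_cokernel f g
}.

Definition simple_object (X : C) : Prop :=
  ~ zero_object X /\
  forall (Y : C) (m : Mor C Y X), mono m -> zero_object Y \/ is_iso m.

Definition semisimple : Prop :=
  forall X : C, exists (n : nat) (F : 'I_n -> C)
      (i : forall k, Mor C (F k) X) (p : forall k, Mor C X (F k)),
    (forall k, simple_object (F k)) /\ direct_sum i p.

Definition finitely_many_simples : Prop :=
  exists (n : nat) (F : 'I_n -> C),
    forall X : C, simple_object X -> exists k, isomorphic X (F k).

Definition finite_dimensional_homs : Prop :=
  forall X Y : C, exists (n : nat) (e : 'I_n -> Mor C X Y),
    forall f : Mor C X Y, exists a : 'I_n -> R[i], f = \sum_(k < n) a k *: e k.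

Record id_automorphism := IdAutomorphism {
  theta :> forall X : C, Mor C X X;
  thetaV : forall X : C, Mor C X X;
  theta_inverse : forall X, is_inverse (theta X) (thetaV X);
  theta_natural : forall (X Y : C) (f : Mor C X Y),
    f ∘ theta X = theta Y ∘ f
}.

End Abelian.

Record tensor_functor (R : realType) (C : linear_category R) := TensorFunctor {
  tens : C -> C -> C;
  tensm : forall X X' Y Y' : C,
    Mor C X X' -> Mor C Y Y' -> Mor C (tens X Y) (tens X' Y');
  tensm_id : forall X Y : C, tensm (id_mor X) (id_mor Y) = id_mor (tens X Y);
  tensm_comp : forall (X X' X'' Y Y' Y'' : C)
      (f' : Mor C X' X'') (f : Mor C X X') (g' : Mor C Y' Y'') (g : Mor C Y Y'),
    tensm (f' ∘ f) (g' ∘ g) = tensm f' g' ∘ tensm f g;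
  tensm_linearl : forall (X X' Y Y' : C) (a : R[i])
      (f f' : Mor C X X') (g : Mor C Y Y'),
    tensm (a *: f + f') g = a *: tensm f g + tensm f' g;
  tensm_linearr : forall (X X' Y Y' : C) (a : R[i])
      (f : Mor C X X') (g g' : Mor C Y Y'),
    tensm f (a *: g + g') = a *: tensm f g + tensm f g'
}.

Section MonoidalStructure.
Variables (R : realType) (C : linear_category R).

Record monoidal_structure := MonoidalStructure {
  tensor :> tensor_functor C;
  unit_ob : C;
  assoc : forall X Y Z : C,
    Mor C (tens tensor (tens tensor X Y) Z) (tens tensor X (tens tensor Y Z));
  assocV : forall X Y Z : C,
    Mor C (tens tensor X (tens tensor Y Z)) (tens tensor (tens tensor X Y) Z);
  lunit : forall X : C, Mor C (tens tensor unit_ob X) X;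
  lunitV : forall X : C, Mor C X (tens tensor unit_ob X);
  runit : forall X : C, Mor C (tens tensor X unit_ob) X;
  runitV : forall X : C, Mor C X (tens tensor X unit_ob);
  assoc_inverse : forall X Y Z, is_inverse (assoc X Y Z) (assocV X Y Z);
  lunit_inverse : forall X, is_inverse (lunit X) (lunitV X);
  runit_inverse : forall X, is_inverse (runit X) (runitV X);
  assoc_natural : forall (X X' Y Y' Z Z' : C)
      (f : Mor C X X') (g : Mor C Y Y') (h : Mor C Z Z'),
    assoc X' Y' Z' ∘ tensm tensor (tensm tensor f g) h
    = tensm tensor f (tensm tensor g h) ∘ assoc X Y Z;
  lunit_natural : forall (X Y : C) (f : Mor C X Y),
    lunit Y ∘ tensm tensor (id_mor unit_ob) f = f ∘ lunit X;
  runit_natural : forall (X Y : C) (f : Mor C X Y),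
    runit Y ∘ tensm tensor f (id_mor unit_ob) = f ∘ runit X;
  pentagon : forall W X Y Z : C,
    tensm tensor (id_mor W) (assoc X Y Z) ∘ assoc W (tens tensor X Y) Z
      ∘ tensm tensor (assoc W X Y) (id_mor Z)
    = assoc W X (tens tensor Y Z) ∘ assoc (tens tensor W X) Y Z;
  triangle : forall X Y : C,
    tensm tensor (id_mor X) (lunit Y) ∘ assoc X unit_ob Y
    = tensm tensor (runit X) (id_mor Y)
}.

End MonoidalStructure.

Section Monoidal.
Variables (R : realType) (C : linear_category R) (M : monoidal_structure C).

Local Notation I := (unit_ob M).
Local Notation "X ⊗ Y" := (tens M X Y) (at level 39, left associativity).
Local Notation "f ⊗₁ g" := (tensm M f g) (at level 39, left associativity).
Local Notation α := (assoc M).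
Local Notation α' := (assocV M).

Record is_dual (X D : C) (ev : Mor C (D ⊗ X) I) (coev : Mor C I (X ⊗ D))
    : Prop := IsDual {
  zigzag_ob :
    runit M X ∘ (id_mor X ⊗₁ ev) ∘ α X D X ∘ (coev ⊗₁ id_mor X) ∘ lunitV M X
    = id_mor X;
  zigzag_dual :
    lunit M D ∘ (ev ⊗₁ id_mor D) ∘ α' D X D ∘ (id_mor D ⊗₁ coev) ∘ runitV M D
    = id_mor D
}.

Definition rigid : Prop :=
  (forall X : C, exists (D : C) (ev : Mor C (D ⊗ X) I) (coev : Mor C I (X ⊗ D)),
     is_dual ev coev) /\
  (forall X : C, exists (D : C) (ev : Mor C (X ⊗ D) I) (coev : Mor C I (D ⊗ X)),
     is_dual ev coev).

Definition transpose (X Y DX DY : C) (coevX : Mor C I (X ⊗ DX))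
    (evY : Mor C (DY ⊗ Y) I) (f : Mor C X Y) : Mor C DY DX :=
  lunit M DX ∘ (evY ⊗₁ id_mor DX) ∘ α' DY Y DX ∘ (id_mor DY ⊗₁ (f ⊗₁ id_mor DX))
    ∘ (id_mor DY ⊗₁ coevX) ∘ runitV M DY.

Record is_fusion : Prop := IsFusion {
  fusion_abelian : is_abelian C;
  fusion_semisimple : semisimple C;
  fusion_rigid : rigid;
  fusion_finite : finitely_many_simples C;
  fusion_hom_finite : finite_dimensional_homs C;
  fusion_unit_simple : simple_object I
}.

Record braiding := Braiding {
  braid :> forall X Y : C, Mor C (X ⊗ Y) (Y ⊗ X);
  braidV : forall X Y : C, Mor C (Y ⊗ X) (X ⊗ Y);
  braid_inverse : forall X Y, is_inverse (braid X Y) (braidV X Y);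
  braid_natural : forall (X X' Y Y' : C) (f : Mor C X X') (g : Mor C Y Y'),
    braid X' Y' ∘ (f ⊗₁ g) = (g ⊗₁ f) ∘ braid X Y;
  hexagon_right : forall X Y Z : C,
    α Y Z X ∘ braid X (Y ⊗ Z) ∘ α X Y Z
    = (id_mor Y ⊗₁ braid X Z) ∘ α Y X Z ∘ (braid X Y ⊗₁ id_mor Z);
  hexagon_left : forall X Y Z : C,
    α' Z X Y ∘ braid (X ⊗ Y) Z ∘ α' X Y Z
    = (braid X Z ⊗₁ id_mor Y) ∘ α' X Z Y ∘ (id_mor X ⊗₁ braid Y Z)
}.

Definition twist (c : braiding) (θ : id_automorphism C) : Prop :=
  forall X Y : C, θ (X ⊗ Y) = (θ X ⊗₁ θ Y) ∘ c Y X ∘ c X Y.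

(* The transpose of [θ X] is required to be [θ D] for every dual [D] of [X];
   this does not depend on the choice of [D]. *)
Definition ribbon (c : braiding) (θ : id_automorphism C) : Prop :=
  twist c θ /\
  forall (X D : C) (ev : Mor C (D ⊗ X) I) (coev : Mor C I (X ⊗ D)),
    is_dual ev coev -> transpose coev ev (θ X) = θ D.

End Monoidal.

Record banach_category (R : realType) := BanachCategory {
  bob : Type;
  bhom : bob -> bob -> completeNormedModType R[i];
  banach_str : @linear_structure R bob (fun X Y => bhom X Y)
}.

Coercion banach_linear (R : realType) (C : banach_category R)
  : linear_category R := LinearCategory (banach_str C).

Definition mor_norm (R : realType) (C : banach_category R) (X Y : C)
    (f : Mor C X Y) : R[i] := `|(f : bhom X Y)|.

(* The order on R[i] is such that 0 <= a means that a is a nonnegative real. *)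
Definition spectrum (R : realType) (C : linear_category R) (X : C)
    (f : Mor C X X) : set R[i] :=
  [set a | ~ is_iso (f - a *: id_mor X)].

Record star_structure (R : realType) (C : linear_category R) := StarStructure {
  star : forall X Y : C, Mor C X Y -> Mor C Y X;
  star_antilinear : forall (X Y : C) (a : R[i]) (f g : Mor C X Y),
    star (a *: f + g) = Num.conj a *: star f + star g;
  star_id : forall X : C, star (id_mor X) = id_mor X;
  star_comp : forall (X Y Z : C) (g : Mor C Y Z) (f : Mor C X Y),
    star (g ∘ f) = star f ∘ star g;
  starK : forall (X Y : C) (f : Mor C X Y), star (star f) = f
}.

Definition positive_endo (R : realType) (C : linear_category R)
    (S : star_structure C) (X : C) (f : Mor C X X) : Prop :=
  star S f = f /\ forall a, spectrum f a -> 0 <= a.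

Definition unitary (R : realType) (C : linear_category R)
    (S : star_structure C) (X Y : C) (u : Mor C X Y) : Prop :=
  u ∘ star S u = id_mor Y /\ star S u ∘ u = id_mor X.

Record cstar_category (R : realType) := CstarCategory {
  cstar_banach :> banach_category R;
  cstar_star : star_structure cstar_banach;
  cstar_abelian : is_abelian cstar_banach;
  norm_comp : forall (X Y Z : cstar_banach)
      (g : Mor cstar_banach Y Z) (f : Mor cstar_banach X Y),
    mor_norm (g ∘ f) <= mor_norm g * mor_norm f;
  cstar_identity : forall (X Y : cstar_banach) (f : Mor cstar_banach X Y),
    mor_norm (star cstar_star f ∘ f) = mor_norm f ^+ 2;
  cstar_positive : forall (X Y : cstar_banach) (f : Mor cstar_banach X Y),
    positive_endo cstar_star (star cstar_star f ∘ f)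
}.

Record unitary_fusion_category (R : realType) := UnitaryFusionCategory {
  ufc_cstar :> cstar_category R;
  ufc_monoidal : monoidal_structure ufc_cstar;
  ufc_fusion : is_fusion ufc_monoidal;
  ufc_assoc_unitary : forall X Y Z : ufc_cstar,
    unitary (cstar_star ufc_cstar) (assoc ufc_monoidal X Y Z);
  ufc_lunit_unitary : forall X : ufc_cstar,
    unitary (cstar_star ufc_cstar) (lunit ufc_monoidal X);
  ufc_runit_unitary : forall X : ufc_cstar,
    unitary (cstar_star ufc_cstar) (runit ufc_monoidal X);
  ufc_star_tensm : forall (X X' Y Y' : ufc_cstar)
      (f : Mor ufc_cstar X X') (g : Mor ufc_cstar Y Y'),
    star (cstar_star ufc_cstar) (tensm ufc_monoidal f g)
    = tensm ufc_monoidal (star (cstar_star ufc_cstar) f)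
                         (star (cstar_star ufc_cstar) g)
}.

Section UnitaryRibbon.
Variables (R : realType) (C : unitary_fusion_category R).

Local Notation M := (ufc_monoidal C).
Local Notation I := (unit_ob M).
Local Notation "X ⊗ Y" := (tens M X Y) (at level 39, left associativity).
Local Notation "f ⊗₁ g" := (tensm M f g) (at level 39, left associativity).
Local Notation "f ^*" := (star (cstar_star C) f).

Definition unitary_ribbon (c : braiding M) (θ : id_automorphism C) : Prop :=
  [/\ ribbon c θ,
      forall X : C, unitary (cstar_star C) (θ X)
    & forall X : C,
        exists (D : C) (ev : Mor C (D ⊗ X) I) (coev : Mor C I (X ⊗ D)),
          [/\ is_dual ev coev,
              coev^* = ev ∘ c X D ∘ (θ X ⊗₁ id_mor D)
            & ev^* = (id_mor D ⊗₁ thetaV θ X) ∘ braidV c D X ∘ coev]].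

End UnitaryRibbon.

(* Main.v *)
Require Import Defs.
From mathcomp Require Import all_boot all_order all_algebra.
From mathcomp Require Import complex.
From mathcomp Require Import all_classical all_reals all_analysis.

Set Implicit Arguments.
Unset Strict Implicit.
Unset Printing Implicit Defensive.

Import Order.TTheory GRing.Theory Num.Theory.
Local Open Scope ring_scope.
Local Open Scope category_scope.

(** The twist is forced on simple objects.  If [X] is simple with dual [D], then
    the adjoint of [coev] and [ev ∘ c X D] are proportional, since morphisms
    from [X ⊗ D] to the unit correspond to endomorphisms of [X].  Rescaling the
    dual changes the factor by positive numbers only, so a unitary twist has to
    act by its phase ([scalar_twist_ex]).  Every object is an orthogonal direct
    sum of simple ones, and these phases extend to a natural unitary
    automorphism ([canonical_twist]).  Three facts show that it is a unitary
    ribbon structure, and the only one.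

    The braiding is unitary ([braid_unitary]).  Carry a simple object [X] by a
    half-braiding across the first strand of a vector [v] from the unit to
    [Y ⊗ E].  The squared length of [v] is multiplied by a factor, which is
    multiplicative when vectors are nested and bounded because there are only
    finitely many simple objects [Y]; so it is at most 1.  This applies as well
    to the adjoint of the inverse half-braiding, and the two estimates force the
    difference of both half-braidings to vanish.

    Unitary twists are unique ([twisted_dual_unique]).  Any two duals of [X] that
    satisfy the first equation of a unitary ribbon structure, each for its own
    unitary twist, differ by an isomorphism [b]; if one of the twists is central,
    then the equations force the positive morphism [b^* b] to be an involution,
    hence to be 1.  So whatever unitary satisfies that equation for some dual is
    the canonical twist.  This gives uniqueness of the ribbon structure, and also
    the axioms: nesting duals of [X] and [Y] produces a dual of [X ⊗ Y] whose
    twist is the product of the two twists with the double braiding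
    ([nested_twisted_dual]), and the adjoint of a dual pair exhibits [X] as a
    dual of [D], the twist being the transpose ([twisted_dual_star]).

    The second equation follows from the first ([twisted_ev]), because a dual pair
    turned over by crossings of opposite signs still satisfies a zigzag identity
    ([braided_zig]).

    The associator is kept out of these arguments by letting an object [X] act as
    the functor [X ⊗ -]: a morphism on [X ⊗ Y] acts on [X ⊗ (Y ⊗ A)] for every
    [A], and the duality becomes an adjunction. *)

(** * Linear categories *)

Section Linear.
Variables (R : realType) (C : linear_category R).
Implicit Types X Y Z W : C.

Lemma mcompA X Y Z W (h : Mor C Z W) (g : Mor C Y Z) (f : Mor C X Y) :
  h ∘ (g ∘ f) = h ∘ g ∘ f.
Proof. exact: ls_compA. Qed.

Lemma comp1m X Y (f : Mor C X Y) : id_mor Y ∘ f = f.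
Proof. exact: ls_comp1m. Qed.

Lemma compm1 X Y (f : Mor C X Y) : f ∘ id_mor X = f.
Proof. exact: ls_compm1. Qed.

Lemma compDl X Y Z (g g' : Mor C Y Z) (f : Mor C X Y) :
  (g + g') ∘ f = g ∘ f + g' ∘ f.
Proof. by have := ls_comp_linearl (linear_str C) 1 g g' f; rewrite !scale1r. Qed.

Lemma compDr X Y Z (g : Mor C Y Z) (f f' : Mor C X Y) :
  g ∘ (f + f') = g ∘ f + g ∘ f'.
Proof. by have := ls_comp_linearr (linear_str C) 1 g f f'; rewrite !scale1r. Qed.

Lemma comp0m X Y Z (f : Mor C X Y) : (0 : Mor C Y Z) ∘ f = 0.
Proof. by apply: (addrI (0 ∘ f)); rewrite -compDl !addr0. Qed.

Lemma compm0 X Y Z (g : Mor C Y Z) : g ∘ (0 : Mor C X Y) = 0.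
Proof. by apply: (addrI (g ∘ 0)); rewrite -compDr !addr0. Qed.

Lemma compZl X Y Z a (g : Mor C Y Z) (f : Mor C X Y) :
  (a *: g) ∘ f = a *: (g ∘ f).
Proof.
have : (a *: g + 0) ∘ f = a *: (g ∘ f) + 0 ∘ f by exact: ls_comp_linearl.
by rewrite comp0m !addr0.
Qed.

Lemma compZr X Y Z a (g : Mor C Y Z) (f : Mor C X Y) :
  g ∘ (a *: f) = a *: (g ∘ f).
Proof.
have : g ∘ (a *: f + 0) = a *: (g ∘ f) + g ∘ 0 by exact: ls_comp_linearr.
by rewrite compm0 !addr0.
Qed.

Lemma compNl X Y Z (g : Mor C Y Z) (f : Mor C X Y) : (- g) ∘ f = - (g ∘ f).
Proof. by rewrite -[- g]scaleN1r compZl scaleN1r. Qed.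

Lemma compNr X Y Z (g : Mor C Y Z) (f : Mor C X Y) : g ∘ (- f) = - (g ∘ f).
Proof. by rewrite -[- f]scaleN1r compZr scaleN1r. Qed.

Lemma comp_suml X Y Z n (g : 'I_n -> Mor C Y Z) (f : Mor C X Y) :
  (\sum_k g k) ∘ f = \sum_k g k ∘ f.
Proof.
by apply: (big_morph (fun g => g ∘ f)) => [g1 g2|]; rewrite ?compDl ?comp0m.
Qed.

Lemma comp_sumr X Y Z n (g : Mor C Y Z) (f : 'I_n -> Mor C X Y) :
  g ∘ (\sum_k f k) = \sum_k g ∘ f k.
Proof.
by apply: (big_morph (fun f => g ∘ f)) => [g1 g2|]; rewrite ?compDr ?compm0.
Qed.

(** Composites are kept associated to the right; this applies an equation
    between composites in front of a further factor. *)
Lemma reassoc X Y Z W (h : Mor C Z W) (g : Mor C Y Z) (k : Mor C Y W)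
    (E : h ∘ g = k) (f : Mor C X Y) : h ∘ (g ∘ f) = k ∘ f.
Proof. by rewrite mcompA E. Qed.

Lemma reassoc3 X Y Z V W (h : Mor C Z W) (g : Mor C Y Z) (k : Mor C X Y)
    (l : Mor C X W) (E : h ∘ (g ∘ k) = l) (f : Mor C V X) :
  h ∘ (g ∘ (k ∘ f)) = l ∘ f.
Proof. by rewrite -E !mcompA. Qed.

Lemma inverse_unique X Y (f : Mor C X Y) (g h : Mor C Y X) :
  g ∘ f = id_mor X -> f ∘ h = id_mor Y -> g = h.
Proof. by move=> gK hK; rewrite -(compm1 g) -hK mcompA gK comp1m. Qed.

Lemma cancel_left X Y Z (g : Mor C Y Z) (g' : Mor C Z Y) (f f' : Mor C X Y) :
  g' ∘ g = id_mor Y -> g ∘ f = g ∘ f' -> f = f'.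
Proof. by move=> gK E; rewrite -[f]comp1m -[f']comp1m -gK -!mcompA E. Qed.

Lemma cancel_right X Y Z (g : Mor C X Y) (g' : Mor C Y X) (f f' : Mor C Y Z) :
  g ∘ g' = id_mor Y -> f ∘ g = f' ∘ g -> f = f'.
Proof. by move=> gK E; rewrite -[f]compm1 -[f']compm1 -gK !mcompA E. Qed.

End Linear.

(** * Monoidal coherence and bends *)

Section Calculus.
Variables (R : realType) (C : linear_category R) (M : monoidal_structure C).
Implicit Types X Y Z W A B D E : C.

Local Notation I := (unit_ob M).
Local Notation "X ⊗ Y" := (tens M X Y) (at level 39, left associativity).
Local Notation "f ⊗₁ g" := (tensm M f g) (at level 39, left associativity).
Local Notation "X ◁ f" := (tensm M (id_mor X) f) (at level 38, right associativity).
Local Notation "f ▷ X" := (tensm M f (id_mor X)) (at level 39, left associativity).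
Local Notation α := (assoc M).
Local Notation α' := (assocV M).
Local Notation λ := (lunit M).
Local Notation λ' := (lunitV M).
Local Notation ρ := (runit M).
Local Notation ρ' := (runitV M).

Lemma assocK X Y Z : α' X Y Z ∘ α X Y Z = id_mor _.
Proof. by case: (assoc_inverse M X Y Z). Qed.
Lemma assocVK X Y Z : α X Y Z ∘ α' X Y Z = id_mor _.
Proof. by case: (assoc_inverse M X Y Z). Qed.
Lemma lunitK X : λ' X ∘ λ X = id_mor _.
Proof. by case: (lunit_inverse M X). Qed.
Lemma lunitVK X : λ X ∘ λ' X = id_mor _.
Proof. by case: (lunit_inverse M X). Qed.
Lemma runitK X : ρ' X ∘ ρ X = id_mor _.
Proof. by case: (runit_inverse M X). Qed.
Lemma runitVK X : ρ X ∘ ρ' X = id_mor _.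
Proof. by case: (runit_inverse M X). Qed.

Lemma lw_comp X A B D (g : Mor C B D) (f : Mor C A B) :
  X ◁ (g ∘ f) = X ◁ g ∘ X ◁ f.
Proof. by rewrite -tensm_comp comp1m. Qed.

Lemma rw_comp X A B D (g : Mor C B D) (f : Mor C A B) :
  (g ∘ f) ▷ X = (g ▷ X) ∘ (f ▷ X).
Proof. by rewrite -tensm_comp comp1m. Qed.

Lemma exchange X Y A B (f : Mor C X Y) (g : Mor C A B) :
  (f ▷ B) ∘ X ◁ g = Y ◁ g ∘ (f ▷ A).
Proof. by rewrite -!tensm_comp !comp1m !compm1. Qed.

Lemma tensmE X Y A B (f : Mor C X Y) (g : Mor C A B) :
  f ⊗₁ g = (f ▷ B) ∘ X ◁ g.
Proof. by rewrite -!tensm_comp !comp1m !compm1. Qed.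

Lemma tensm0l X X' Y Y' (g : Mor C Y Y') : (0 : Mor C X X') ⊗₁ g = 0.
Proof.
have := tensm_linearl M 1 (0 : Mor C X X') 0 g.
by rewrite scaler0 addr0 scale1r => /(congr1 (+%R^~ (- (0 ⊗₁ g)))); rewrite addrK subrr.
Qed.

Lemma tensm0r X X' Y Y' (f : Mor C X X') : f ⊗₁ (0 : Mor C Y Y') = 0.
Proof.
have := tensm_linearr M 1 f (0 : Mor C Y Y') 0.
by rewrite scaler0 addr0 scale1r => /(congr1 (+%R^~ (- (f ⊗₁ 0)))); rewrite addrK subrr.
Qed.

Lemma tensmDl X X' Y Y' (f f' : Mor C X X') (g : Mor C Y Y') :
  (f + f') ⊗₁ g = f ⊗₁ g + f' ⊗₁ g.
Proof. by have := tensm_linearl M 1 f f' g; rewrite !scale1r. Qed.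

Lemma tensmDr X X' Y Y' (f : Mor C X X') (g g' : Mor C Y Y') :
  f ⊗₁ (g + g') = f ⊗₁ g + f ⊗₁ g'.
Proof. by have := tensm_linearr M 1 f g g'; rewrite !scale1r. Qed.

Lemma tensmZl X X' Y Y' a (f : Mor C X X') (g : Mor C Y Y') :
  (a *: f) ⊗₁ g = a *: (f ⊗₁ g).
Proof. by have := tensm_linearl M a f 0 g; rewrite !addr0 tensm0l addr0. Qed.

Lemma tensmZr X X' Y Y' a (f : Mor C X X') (g : Mor C Y Y') :
  f ⊗₁ (a *: g) = a *: (f ⊗₁ g).
Proof. by have := tensm_linearr M a f g 0; rewrite !addr0 tensm0r addr0. Qed.

Lemma tensm_suml X X' Y Y' n (f : 'I_n -> Mor C X X') (g : Mor C Y Y') :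
  (\sum_k f k) ⊗₁ g = \sum_k f k ⊗₁ g.
Proof.
by apply: (big_morph (fun f => f ⊗₁ g)) => [f1 f2|]; rewrite ?tensmDl ?tensm0l.
Qed.

Lemma tensm_sumr X X' Y Y' n (f : Mor C X X') (g : 'I_n -> Mor C Y Y') :
  f ⊗₁ (\sum_k g k) = \sum_k f ⊗₁ g k.
Proof.
by apply: (big_morph (fun g => f ⊗₁ g)) => [f1 f2|]; rewrite ?tensmDr ?tensm0r.
Qed.

Lemma lunit_inj X Y (f g : Mor C X Y) : I ◁ f = I ◁ g -> f = g.
Proof.
move=> E; apply: (cancel_right (lunitVK X)).
by rewrite -!lunit_natural E.
Qed.

Lemma runit_inj X Y (f g : Mor C X Y) : f ▷ I = g ▷ I -> f = g.
Proof.
move=> E; apply: (cancel_right (runitVK X)).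
by rewrite -!runit_natural E.
Qed.

Lemma assocV_natural X X' Y Y' Z Z' (f : Mor C X X') (g : Mor C Y Y') (h : Mor C Z Z') :
  α' X' Y' Z' ∘ (f ⊗₁ (g ⊗₁ h)) = ((f ⊗₁ g) ⊗₁ h) ∘ α' X Y Z.
Proof.
apply: (cancel_left (assocK _ _ _)); rewrite mcompA assocVK comp1m.
by rewrite mcompA assoc_natural -mcompA assocVK compm1.
Qed.

(** After tensoring with the unit on the left, both sides appear in the pentagon
    for [I, I, X, Y], where two triangles identify them (Kelly). *)
Lemma lunit_tensor X Y : λ (X ⊗ Y) ∘ α I X Y = λ X ▷ Y.
Proof.
apply: lunit_inj.
have K : (α I I X ▷ Y) ∘ (α' I I X ▷ Y) = id_mor _.
  by rewrite -rw_comp assocVK tensm_id.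
apply: (cancel_right (assocVK I (I ⊗ X) Y)); apply: (cancel_right K).
rewrite lw_comp -!mcompA (mcompA (I ◁ α I X Y)) pentagon mcompA triangle.
rewrite -tensm_id -assoc_natural mcompA -assoc_natural -mcompA -rw_comp.
by rewrite triangle.
Qed.

Lemma assoc_natural1 X X' Y Z (f : Mor C X X') :
  α X' Y Z ∘ (f ▷ Y ▷ Z) = f ▷ (Y ⊗ Z) ∘ α X Y Z.
Proof. by rewrite assoc_natural tensm_id. Qed.

Lemma assoc_natural3 X Y Z Z' (h : Mor C Z Z') :
  α X Y Z' ∘ (X ⊗ Y) ◁ h = X ◁ Y ◁ h ∘ α X Y Z.
Proof. by rewrite -tensm_id assoc_natural. Qed.

Lemma assocV_natural1 X X' Y Z (f : Mor C X X') :
  α' X' Y Z ∘ f ▷ (Y ⊗ Z) = (f ▷ Y ▷ Z) ∘ α' X Y Z.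
Proof. by rewrite -tensm_id assocV_natural. Qed.

Lemma assocV_natural3 X Y Z Z' (h : Mor C Z Z') :
  α' X Y Z' ∘ X ◁ Y ◁ h = (X ⊗ Y) ◁ h ∘ α' X Y Z.
Proof. by rewrite assocV_natural tensm_id. Qed.

Lemma lunitV_natural X Y (f : Mor C X Y) : λ' Y ∘ f = I ◁ f ∘ λ' X.
Proof.
apply: (cancel_left (lunitK Y)); rewrite mcompA lunitVK comp1m.
by rewrite mcompA lunit_natural -mcompA lunitVK compm1.
Qed.

Lemma pentagon_lwVl W X Y Z :
  α' W X (Y ⊗ Z) ∘ W ◁ α X Y Z
  = α (W ⊗ X) Y Z ∘ (α' W X Y ▷ Z) ∘ α' W (X ⊗ Y) Z.
Proof.
have K : (α W X Y ▷ Z) ∘ (α' W X Y ▷ Z) = id_mor _.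
  by rewrite -rw_comp assocVK tensm_id.
have K' : (α' W X Y ▷ Z) ∘ (α W X Y ▷ Z) = id_mor _.
  by rewrite -rw_comp assocK tensm_id.
apply: (cancel_left (assocK _ _ _)).
apply: (cancel_right (assocVK _ _ _)); apply: (cancel_right K).
rewrite -!mcompA (reassoc (assocVK _ _ _)) comp1m mcompA pentagon.
by rewrite (reassoc (assocK _ _ _)) comp1m K' compm1.
Qed.

Lemma pentagon_lwVr W X Y Z :
  W ◁ α' X Y Z ∘ α W X (Y ⊗ Z)
  = α W (X ⊗ Y) Z ∘ (α W X Y ▷ Z) ∘ α' (W ⊗ X) Y Z.
Proof.
have K : (W ◁ α X Y Z) ∘ (W ◁ α' X Y Z) = id_mor _.
  by rewrite -lw_comp assocVK tensm_id.
have K' : (W ◁ α' X Y Z) ∘ (W ◁ α X Y Z) = id_mor _.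
  by rewrite -lw_comp assocK tensm_id.
apply: (cancel_left K').
apply: (cancel_right (assocVK _ _ _)).
rewrite -!mcompA (reassoc K) comp1m assocK compm1.
by rewrite -pentagon -!mcompA.
Qed.

(** Strings of objects are bracketed to the right and end in a free object [A],
    so that associators are absent from statements; [cap], [cup] and [act2] let
    morphisms act on the first two strings.  They are locked, since rewriting
    would otherwise find composites inside them. *)
Definition cap X Y (φ : Mor C (X ⊗ Y) I) A : Mor C (X ⊗ (Y ⊗ A)) A :=
  locked (λ A ∘ φ ▷ A ∘ α' X Y A).

Definition cup X Y (ψ : Mor C I (X ⊗ Y)) A : Mor C A (X ⊗ (Y ⊗ A)) :=
  locked (α X Y A ∘ ψ ▷ A ∘ λ' A).

Definition act2 X Y X' Y' (s : Mor C (X ⊗ Y) (X' ⊗ Y')) A :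
    Mor C (X ⊗ (Y ⊗ A)) (X' ⊗ (Y' ⊗ A)) :=
  locked (α X' Y' A ∘ s ▷ A ∘ α' X Y A).

Lemma capE X Y (φ : Mor C (X ⊗ Y) I) A : cap φ A = λ A ∘ φ ▷ A ∘ α' X Y A.
Proof. by rewrite /cap -lock. Qed.

Lemma cupE X Y (ψ : Mor C I (X ⊗ Y)) A : cup ψ A = α X Y A ∘ ψ ▷ A ∘ λ' A.
Proof. by rewrite /cup -lock. Qed.

Lemma cap_natural X Y (φ : Mor C (X ⊗ Y) I) A B (f : Mor C A B) :
  cap φ B ∘ X ◁ Y ◁ f = f ∘ cap φ A.
Proof.
rewrite /cap -!lock -!mcompA assocV_natural3 (reassoc (exchange φ f)) -!mcompA.
by rewrite (reassoc (lunit_natural M f)) -!mcompA.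
Qed.

Lemma cup_natural X Y (ψ : Mor C I (X ⊗ Y)) A B (f : Mor C A B) :
  cup ψ B ∘ f = X ◁ Y ◁ f ∘ cup ψ A.
Proof.
rewrite /cup -!lock -!mcompA lunitV_natural (reassoc (exchange ψ f)) -!mcompA.
by rewrite (reassoc (assoc_natural3 X Y f)) -!mcompA.
Qed.

Lemma act2_natural X Y X' Y' (s : Mor C (X ⊗ Y) (X' ⊗ Y')) A B (f : Mor C A B) :
  act2 s B ∘ X ◁ Y ◁ f = X' ◁ Y' ◁ f ∘ act2 s A.
Proof.
rewrite /act2 -!lock -!mcompA assocV_natural3 (reassoc (exchange s f)) -!mcompA.
by rewrite (reassoc (assoc_natural3 X' Y' f)) -!mcompA.
Qed.

Lemma cap_inj X Y (φ φ' : Mor C (X ⊗ Y) I) :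
  (forall A, cap φ A = cap φ' A) -> φ = φ'.
Proof.
move/(_ I); rewrite /cap -!lock => E; apply: runit_inj; apply: (cancel_left (lunitK I)).
exact: (cancel_right (assocK X Y I) E).
Qed.

Lemma cup_inj X Y (ψ ψ' : Mor C I (X ⊗ Y)) :
  (forall A, cup ψ A = cup ψ' A) -> ψ = ψ'.
Proof.
move/(_ I); rewrite /cup -!lock => E; apply: runit_inj; apply: (cancel_left (assocK X Y I)).
exact: (cancel_right (lunitK I) E).
Qed.

Lemma rw_inj X Y (f g : Mor C X Y) : (forall A, f ▷ A = g ▷ A) -> f = g.
Proof. by move=> E; apply: runit_inj. Qed.

Lemma cap_act2 X Y X' Y' (φ : Mor C (X' ⊗ Y') I) (s : Mor C (X ⊗ Y) (X' ⊗ Y')) A :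
  cap (φ ∘ s) A = cap φ A ∘ act2 s A.
Proof.
by rewrite /cap /act2 -!lock rw_comp -!mcompA (reassoc (assocK _ _ _)) comp1m.
Qed.

Lemma act2_cup X Y X' Y' (s : Mor C (X ⊗ Y) (X' ⊗ Y')) (ψ : Mor C I (X ⊗ Y)) A :
  cup (s ∘ ψ) A = act2 s A ∘ cup ψ A.
Proof.
by rewrite /cup /act2 -!lock rw_comp -!mcompA (reassoc (assocK _ _ _)) comp1m.
Qed.

Lemma act2_comp X Y X' Y' X'' Y'' (t : Mor C (X' ⊗ Y') (X'' ⊗ Y''))
    (s : Mor C (X ⊗ Y) (X' ⊗ Y')) A :
  act2 (t ∘ s) A = act2 t A ∘ act2 s A.
Proof.
by rewrite /act2 -!lock rw_comp -!mcompA (reassoc (assocK _ _ _)) comp1m.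
Qed.

Lemma act2_id X Y A : act2 (id_mor (X ⊗ Y)) A = id_mor _.
Proof. by rewrite /act2 -!lock tensm_id compm1 assocVK. Qed.

Lemma act2_lw X Y Y' (g : Mor C Y Y') A : act2 (X ◁ g) A = X ◁ (g ▷ A).
Proof. by rewrite /act2 -!lock assoc_natural -mcompA assocVK compm1. Qed.

Lemma act2_rw X X' Y (f : Mor C X X') A : act2 (f ▷ Y) A = f ▷ (Y ⊗ A).
Proof. by rewrite /act2 -!lock assoc_natural1 -mcompA assocVK compm1. Qed.

(** The two bends need not belong to one dual pair; this covers transposes and
    the comparison of different duals. *)
Definition zig X Y D (ψ : Mor C I (X ⊗ D)) (φ : Mor C (D ⊗ Y) I) : Mor C Y X :=
  locked (ρ X ∘ X ◁ φ ∘ α X D Y ∘ ψ ▷ Y ∘ λ' Y).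

Definition zag E Y D (φ : Mor C (E ⊗ Y) I) (ψ : Mor C I (Y ⊗ D)) : Mor C E D :=
  locked (λ D ∘ φ ▷ D ∘ α' E Y D ∘ E ◁ ψ ∘ ρ' E).

Lemma triangleV X Y : α' X I Y ∘ X ◁ λ' Y = ρ' X ▷ Y.
Proof.
have K : (ρ' X ▷ Y) ∘ (ρ X ▷ Y) = id_mor _ by rewrite -rw_comp runitK tensm_id.
apply: (cancel_left (g := ρ X ▷ Y) K).
rewrite -rw_comp runitVK tensm_id -triangle -mcompA (reassoc (assocVK _ _ _)).
by rewrite comp1m -lw_comp lunitVK tensm_id.
Qed.

Lemma lunitV_tensor X Y : α' I X Y ∘ λ' (X ⊗ Y) = λ' X ▷ Y.
Proof.
have K : (λ' X ▷ Y) ∘ (λ X ▷ Y) = id_mor _ by rewrite -rw_comp lunitK tensm_id.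
apply: (cancel_left (g := λ X ▷ Y) K).
rewrite -rw_comp lunitVK tensm_id -lunit_tensor -mcompA (reassoc (assocVK _ _ _)).
by rewrite comp1m lunitVK.
Qed.

Lemma lw_cup X Y E (v : Mor C I (Y ⊗ E)) A :
  α' X Y (E ⊗ A) ∘ X ◁ cup v A
  = α (X ⊗ Y) E A ∘ (α' X Y E ∘ X ◁ v ∘ ρ' X) ▷ A.
Proof.
rewrite /cup -!lock !lw_comp !rw_comp -!mcompA (reassoc (pentagon_lwVl _ _ _ _)) -!mcompA.
by rewrite (reassoc (assocV_natural _ v _)) -!mcompA triangleV.
Qed.

Lemma lw_cap X Y D (φ : Mor C (D ⊗ Y) I) A :
  X ◁ cap φ A ∘ α X D (Y ⊗ A)
  = (ρ X ∘ X ◁ φ ∘ α X D Y) ▷ A ∘ α' (X ⊗ D) Y A.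
Proof.
rewrite /cap -!lock !lw_comp !rw_comp -!mcompA pentagon_lwVr -!mcompA.
rewrite -triangle -!mcompA (reassoc (assoc_natural _ _ _ _)).
by rewrite -!mcompA.
Qed.

(** In the functorial form zigzags contain no associators, which turns the
    identities between them into naturality squares. *)
Lemma zig_rw X Y D (ψ : Mor C I (X ⊗ D)) (φ : Mor C (D ⊗ Y) I) A :
  zig ψ φ ▷ A = X ◁ cap φ A ∘ cup ψ (Y ⊗ A).
Proof.
rewrite /cup -!lock -!mcompA (reassoc (lw_cap X φ A)) -!mcompA.
rewrite (reassoc (assocV_natural1 Y A ψ)) -!mcompA lunitV_tensor.
by rewrite /zig -!lock !rw_comp -!mcompA.
Qed.

Lemma zag_rw E Y D (φ : Mor C (E ⊗ Y) I) (ψ : Mor C I (Y ⊗ D)) A :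
  zag φ ψ ▷ A = cap φ (D ⊗ A) ∘ E ◁ cup ψ A.
Proof.
rewrite /cap -!lock -!mcompA lw_cup (reassoc (esym (assoc_natural1 _ _ φ))) -!mcompA.
by rewrite (reassoc (lunit_tensor D A)) /zag -!lock !rw_comp -!mcompA.
Qed.

Lemma is_dualP X D (ev : Mor C (D ⊗ X) I) (coev : Mor C I (X ⊗ D)) :
  is_dual ev coev <-> zig coev ev = id_mor X /\ zag ev coev = id_mor D.
Proof. by rewrite /zig /zag -!lock; split; case. Qed.

(** * Zigzags and duals *)

Lemma transposeE X Y DX DY (coevX : Mor C I (X ⊗ DX)) (evY : Mor C (DY ⊗ Y) I)
    (f : Mor C X Y) :
  transpose coevX evY f = zag evY (f ▷ DX ∘ coevX).
Proof. by rewrite /zag -!lock lw_comp !mcompA. Qed.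

(** Sliding a morphism around a bend; both sides are the same zigzag. *)
Lemma zag_slide X Y D E (φ : Mor C (E ⊗ Y) I) (ψ : Mor C I (Y ⊗ D)) (ev : Mor C (D ⊗ X) I) :
  ev ∘ zag φ ψ ▷ X = φ ∘ E ◁ zig ψ ev.
Proof.
apply: cap_inj => A; rewrite !cap_act2 act2_lw act2_rw zig_rw zag_rw lw_comp.
by rewrite !mcompA cap_natural.
Qed.

(** The zigzag identity straightens the strand of a dual pair, so that any bend
    is a zigzag composed with the bend of the pair; likewise below. *)
Lemma zag_yank Y D E (ev : Mor C (E ⊗ Y) I) (coev : Mor C I (Y ⊗ E)) (ψ : Mor C I (Y ⊗ D)) :
  zig coev ev = id_mor Y -> Y ◁ zag ev ψ ∘ coev = ψ.
Proof.
move=> K; apply: cup_inj => A; rewrite !act2_cup act2_lw zag_rw lw_comp.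
by rewrite -mcompA -cup_natural mcompA -zig_rw K tensm_id comp1m.
Qed.

Lemma zig_yank X Y D (ev : Mor C (D ⊗ X) I) (coev : Mor C I (X ⊗ D)) (ψ : Mor C I (Y ⊗ D)) :
  zag ev coev = id_mor D -> zig ψ ev ▷ D ∘ coev = ψ.
Proof.
move=> K; apply: cup_inj => A; rewrite !act2_cup act2_rw zig_rw.
by rewrite -mcompA cup_natural mcompA -lw_comp -zag_rw K tensm_id tensm_id comp1m.
Qed.

Lemma zag_yank_ev X D E (ev : Mor C (D ⊗ X) I) (coev : Mor C I (X ⊗ D)) (φ : Mor C (E ⊗ X) I) :
  zig coev ev = id_mor X -> ev ∘ zag φ coev ▷ X = φ.
Proof. by move=> K; rewrite zag_slide K tensm_id compm1. Qed.

Lemma zig_yank_ev X Y E (ev : Mor C (E ⊗ Y) I) (coev : Mor C I (Y ⊗ E)) (φ : Mor C (E ⊗ X) I) :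
  zag ev coev = id_mor E -> ev ∘ E ◁ zig coev φ = φ.
Proof. by move=> K; rewrite -zag_slide K tensm_id compm1. Qed.

Lemma zig_compr X Y Z D (ψ : Mor C I (X ⊗ D)) (φ : Mor C (D ⊗ Y) I) (f : Mor C Z Y) :
  zig ψ (φ ∘ D ◁ f) = zig ψ φ ∘ f.
Proof.
apply: rw_inj => A; rewrite rw_comp !zig_rw cap_act2 act2_lw lw_comp.
by rewrite -!mcompA cup_natural.
Qed.

Lemma zig_compl X Y Z D (ψ : Mor C I (X ⊗ D)) (φ : Mor C (D ⊗ Y) I) (f : Mor C X Z) :
  zig (f ▷ D ∘ ψ) φ = f ∘ zig ψ φ.
Proof.
apply: rw_inj => A; rewrite rw_comp !zig_rw act2_cup act2_rw.
by rewrite mcompA -exchange -mcompA.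
Qed.

Lemma zag_compr F E Y D (φ : Mor C (E ⊗ Y) I) (ψ : Mor C I (Y ⊗ D)) (d : Mor C F E) :
  zag (φ ∘ d ▷ Y) ψ = zag φ ψ ∘ d.
Proof.
apply: rw_inj => A; rewrite rw_comp !zag_rw cap_act2 act2_rw.
by rewrite -mcompA exchange mcompA.
Qed.

Lemma zag_compl F E Y D (φ : Mor C (E ⊗ Y) I) (ψ : Mor C I (Y ⊗ D)) (d : Mor C D F) :
  zag φ (Y ◁ d ∘ ψ) = d ∘ zag φ ψ.
Proof.
apply: rw_inj => A; rewrite rw_comp !zag_rw act2_cup act2_lw lw_comp.
by rewrite mcompA cap_natural -mcompA.
Qed.

Lemma zig_mid X Y D E (ψ : Mor C I (X ⊗ D)) (φ : Mor C (E ⊗ Y) I) (d : Mor C D E) :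
  zig (X ◁ d ∘ ψ) φ = zig ψ (φ ∘ d ▷ Y).
Proof.
apply: rw_inj => A; rewrite !zig_rw act2_cup cap_act2 act2_lw act2_rw lw_comp.
by rewrite -!mcompA.
Qed.

Lemma zag_mid X Y D E (φ : Mor C (E ⊗ Y) I) (ψ : Mor C I (X ⊗ D)) (f : Mor C X Y) :
  zag (φ ∘ E ◁ f) ψ = zag φ (f ▷ D ∘ ψ).
Proof.
apply: rw_inj => A; rewrite !zag_rw act2_cup cap_act2 act2_lw act2_rw lw_comp.
by rewrite -!mcompA.
Qed.

Lemma zigE X Y D (ψ : Mor C I (X ⊗ D)) (φ : Mor C (D ⊗ Y) I) :
  zig ψ φ = ρ X ∘ X ◁ φ ∘ α X D Y ∘ ψ ▷ Y ∘ λ' Y.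
Proof. by rewrite /zig -lock. Qed.

Lemma zagE E Y D (φ : Mor C (E ⊗ Y) I) (ψ : Mor C I (Y ⊗ D)) :
  zag φ ψ = λ D ∘ φ ▷ D ∘ α' E Y D ∘ E ◁ ψ ∘ ρ' E.
Proof. by rewrite /zag -lock. Qed.

Lemma zig_suml X Y D n (ψ : 'I_n -> Mor C I (X ⊗ D)) (φ : Mor C (D ⊗ Y) I) :
  zig (\sum_k ψ k) φ = \sum_k zig (ψ k) φ.
Proof.
rewrite zigE tensm_suml comp_sumr comp_suml.
by apply: eq_bigr => k _; rewrite zigE.
Qed.

Lemma zig_sumr X Y D n (ψ : Mor C I (X ⊗ D)) (φ : 'I_n -> Mor C (D ⊗ Y) I) :
  zig ψ (\sum_k φ k) = \sum_k zig ψ (φ k).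
Proof.
rewrite zigE tensm_sumr comp_sumr !comp_suml.
by apply: eq_bigr => k _; rewrite zigE.
Qed.

Lemma zag_suml E Y D n (φ : 'I_n -> Mor C (E ⊗ Y) I) (ψ : Mor C I (Y ⊗ D)) :
  zag (\sum_k φ k) ψ = \sum_k zag (φ k) ψ.
Proof.
rewrite zagE tensm_suml comp_sumr !comp_suml.
by apply: eq_bigr => k _; rewrite zagE.
Qed.

Lemma zag_sumr E Y D n (φ : Mor C (E ⊗ Y) I) (ψ : 'I_n -> Mor C I (Y ⊗ D)) :
  zag φ (\sum_k ψ k) = \sum_k zag φ (ψ k).
Proof.
rewrite zagE tensm_sumr comp_sumr !comp_suml.
by apply: eq_bigr => k _; rewrite zagE.
Qed.

Lemma zig0r X Y D (ψ : Mor C I (X ⊗ D)) : zig ψ (0 : Mor C (D ⊗ Y) I) = 0.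
Proof. by rewrite zigE tensm0r compm0 !comp0m. Qed.

Lemma zag0r E Y D (φ : Mor C (E ⊗ Y) I) : zag φ (0 : Mor C I (Y ⊗ D)) = 0.
Proof. by rewrite zagE tensm0r compm0 !comp0m. Qed.

Lemma zig0l X Y D (φ : Mor C (D ⊗ Y) I) : zig (0 : Mor C I (X ⊗ D)) φ = 0.
Proof. by rewrite zigE tensm0l compm0 comp0m. Qed.

(** * Duals of tensor products *)

(** In the evaluation [D, X] is the inner pair, in the coevaluation the outer
    one. *)
Definition nest_ev X Y D E (φ : Mor C (D ⊗ X) I) (φ' : Mor C (E ⊗ Y) I) :
    Mor C ((E ⊗ D) ⊗ (X ⊗ Y)) I :=
  φ' ∘ E ◁ cap φ Y ∘ α E D (X ⊗ Y).

Definition nest_coev X Y D E (ψ : Mor C I (X ⊗ D)) (ψ' : Mor C I (Y ⊗ E)) :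
    Mor C I ((X ⊗ Y) ⊗ (E ⊗ D)) :=
  α' X Y (E ⊗ D) ∘ X ◁ cup ψ' D ∘ ψ.

Lemma nest_ev_comp X Y D D' E E' (φ : Mor C (D ⊗ X) I) (φ' : Mor C (E ⊗ Y) I)
    (d : Mor C D' D) (e : Mor C E' E) :
  nest_ev (φ ∘ d ▷ X) (φ' ∘ e ▷ Y) = nest_ev φ φ' ∘ (e ⊗₁ d) ▷ (X ⊗ Y).
Proof.
rewrite /nest_ev cap_act2 act2_rw lw_comp -!mcompA (reassoc (exchange e _)) -!mcompA.
by rewrite assoc_natural (reassoc (esym (tensmE e _))).
Qed.

Lemma cap_rw X Y D (φ : Mor C (D ⊗ X) I) A :
  cap φ Y ▷ A = cap φ (Y ⊗ A) ∘ D ◁ α X Y A ∘ α D (X ⊗ Y) A.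
Proof.
have K : (α' D X Y ▷ A) ∘ (α D X Y ▷ A) = id_mor _.
  by rewrite -rw_comp assocK tensm_id.
have K' : (α D X Y ▷ A) ∘ (α' D X Y ▷ A) = id_mor _.
  by rewrite -rw_comp assocVK tensm_id.
apply: (cancel_right K'); rewrite /cap -!lock !rw_comp -!mcompA K compm1.
rewrite (mcompA (D ◁ _)) pentagon (reassoc (assocK _ _ _)) comp1m -lunit_tensor -mcompA.
by rewrite assoc_natural1.
Qed.

Lemma cup_rw Y D E (ψ : Mor C I (Y ⊗ E)) A :
  α Y (E ⊗ D) A ∘ cup ψ D ▷ A = Y ◁ α' E D A ∘ cup ψ (D ⊗ A).
Proof.
rewrite /cup -!lock !rw_comp -!mcompA (reassoc (pentagon_lwVr _ _ _ _)) -!mcompA.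
rewrite (reassoc (assocV_natural1 _ _ _)) -!mcompA lunitV_tensor.
by [].
Qed.

Lemma cap_nest X Y D E (φ : Mor C (D ⊗ X) I) (φ' : Mor C (E ⊗ Y) I) A :
  cap (nest_ev φ φ') A
  = cap φ' A ∘ E ◁ cap φ (Y ⊗ A) ∘ E ◁ D ◁ α X Y A ∘ α E D ((X ⊗ Y) ⊗ A).
Proof.
rewrite /nest_ev [in LHS]capE [cap φ' A]capE !rw_comp -!mcompA.
have -> : (E ◁ cap φ Y) ▷ A
    = α' E Y A ∘ E ◁ (cap φ Y ▷ A) ∘ α E (D ⊗ (X ⊗ Y)) A.
  by rewrite -mcompA -assoc_natural (reassoc (assocK _ _ _)) comp1m.
rewrite cap_rw !lw_comp -!mcompA (mcompA (α E (D ⊗ (X ⊗ Y)) A)).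
rewrite (mcompA (E ◁ α D (X ⊗ Y) A)) (mcompA (E ◁ α D (X ⊗ Y) A)) pentagon.
by rewrite -!mcompA assocVK compm1.
Qed.

Lemma cup_nest X Y D E (ψ : Mor C I (X ⊗ D)) (ψ' : Mor C I (Y ⊗ E)) A :
  cup (nest_coev ψ ψ') A
  = α' X Y ((E ⊗ D) ⊗ A) ∘ X ◁ Y ◁ α' E D A ∘ X ◁ cup ψ' (D ⊗ A) ∘ cup ψ A.
Proof.
rewrite /nest_coev [in LHS]cupE [cup ψ A]cupE !rw_comp -!mcompA.
have K : (α X Y (E ⊗ D) ▷ A) ∘ (α' X Y (E ⊗ D) ▷ A) = id_mor _.
  by rewrite -rw_comp assocVK tensm_id.
rewrite -(comp1m (α (X ⊗ Y) (E ⊗ D) A ∘ _)) -(assocK X Y) -!mcompA.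
rewrite [in LHS](mcompA (α X Y _)) -pentagon -!mcompA (reassoc K) comp1m.
rewrite (reassoc (assoc_natural _ _ _ _)) -!mcompA.
rewrite [in LHS](reassoc (esym (lw_comp _ _ _))) cup_rw lw_comp -!mcompA.
by [].
Qed.

(** Each zigzag of the nested bends contains a zigzag of one pair, which
    straightens and leaves a zigzag of the other. *)
Lemma nested_dual X Y D E (ev : Mor C (D ⊗ X) I) (coev : Mor C I (X ⊗ D))
    (ev' : Mor C (E ⊗ Y) I) (coev' : Mor C I (Y ⊗ E)) :
  is_dual ev coev -> is_dual ev' coev' ->
  is_dual (nest_ev ev ev') (nest_coev coev coev').
Proof.
move=> /is_dualP[Z1 Z2] /is_dualP[Z1' Z2']; apply/is_dualP; split.
  apply: rw_inj => A; rewrite zig_rw cap_nest cup_nest tensm_id.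
  rewrite -(comp1m ((X ⊗ Y) ◁ _)) -(assocK X Y) -!mcompA.
  rewrite (reassoc (assoc_natural3 _ _ _)) -!mcompA.
  rewrite (reassoc (assocVK _ _ _)) comp1m !lw_comp -!mcompA.
  have K : X ◁ Y ◁ α E D ((X ⊗ Y) ⊗ A) ∘ X ◁ Y ◁ α' E D ((X ⊗ Y) ⊗ A) = id_mor _.
    by rewrite -!lw_comp assocVK !tensm_id.
  rewrite (reassoc K) comp1m.
  have K2 : X ◁ Y ◁ E ◁ (cap ev (Y ⊗ A) ∘ D ◁ α X Y A)
       ∘ X ◁ cup coev' (D ⊗ ((X ⊗ Y) ⊗ A))
     = X ◁ cup coev' (Y ⊗ A) ∘ X ◁ (cap ev (Y ⊗ A) ∘ D ◁ α X Y A).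
    by rewrite -!lw_comp cup_natural.
  move: K2; rewrite !lw_comp -!mcompA => K2.
  rewrite (mcompA (X ◁ Y ◁ E ◁ D ◁ _)) (reassoc K2) -!mcompA -cup_natural.
  rewrite (reassoc (esym (zig_rw _ _ _))) Z1 tensm_id comp1m.
  rewrite (reassoc (esym (lw_comp _ _ _))) -zig_rw Z1' !tensm_id comp1m.
  by rewrite assocK.
apply: rw_inj => A; rewrite zag_rw cap_nest cup_nest tensm_id -!mcompA.
rewrite assoc_natural3 !lw_comp -!mcompA.
have K : E ◁ D ◁ α X Y ((E ⊗ D) ⊗ A) ∘ E ◁ D ◁ α' X Y ((E ⊗ D) ⊗ A) = id_mor _.
  by rewrite -!lw_comp assocVK !tensm_id.
rewrite (reassoc K) comp1m.
have K2 : E ◁ cap ev (Y ⊗ ((E ⊗ D) ⊗ A))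
    ∘ (E ◁ D ◁ X ◁ Y ◁ α' E D A ∘ E ◁ D ◁ X ◁ cup coev' (D ⊗ A))
  = E ◁ Y ◁ α' E D A ∘ E ◁ cup coev' (D ⊗ A) ∘ E ◁ cap ev (D ⊗ A).
  by rewrite -!lw_comp cap_natural.
rewrite (mcompA (E ◁ D ◁ X ◁ Y ◁ _)) (reassoc K2) -!mcompA.
rewrite (reassoc (cap_natural _ _)) -!mcompA (reassoc (esym (zag_rw _ _ _))).
rewrite Z2' tensm_id comp1m (reassoc (esym (lw_comp _ _ _))) -zag_rw Z2.
by rewrite !tensm_id comp1m assocK.
Qed.

(** * Half-braidings *)

(** A braiding gives two half-braidings on every object, [braid_over] and
    [braid_under], and the adjoints of the inverses of a half-braiding form
    another one; strands slide and masses are estimated alike for all of them. *)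
Record half_braiding X := HalfBraiding {
  hb : forall Y, Mor C (X ⊗ Y) (Y ⊗ X);
  hbV : forall Y, Mor C (Y ⊗ X) (X ⊗ Y);
  hb_inverse : forall Y, is_inverse (hb Y) (hbV Y);
  hb_natural : forall Y Y' (f : Mor C Y Y'), hb Y' ∘ X ◁ f = f ▷ X ∘ hb Y;
  hb_hexagon : forall Y Z,
    α Y Z X ∘ hb (Y ⊗ Z) ∘ α X Y Z = Y ◁ hb Z ∘ α Y X Z ∘ hb Y ▷ Z
}.

Section HalfBraiding.
Variables (X : C) (σ : half_braiding X).

Lemma hbK Y : hbV σ Y ∘ hb σ Y = id_mor _.
Proof. by case: (hb_inverse σ Y). Qed.

Lemma hbVK Y : hb σ Y ∘ hbV σ Y = id_mor _.
Proof. by case: (hb_inverse σ Y). Qed.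

Lemma hbV_natural Y Y' (f : Mor C Y Y') : X ◁ f ∘ hbV σ Y = hbV σ Y' ∘ f ▷ X.
Proof.
apply: (cancel_left (hbK Y')).
by rewrite mcompA hb_natural -!mcompA hbVK compm1 (reassoc (hbVK Y')) comp1m.
Qed.

Lemma hbV_hexagon Y Z :
  α' X Y Z ∘ hbV σ (Y ⊗ Z) ∘ α' Y Z X
  = hbV σ Y ▷ Z ∘ α' Y X Z ∘ Y ◁ hbV σ Z.
Proof.
apply: (inverse_unique (f := α Y Z X ∘ hb σ (Y ⊗ Z) ∘ α X Y Z)).
  rewrite -!mcompA (reassoc (assocK _ _ _)) comp1m (reassoc (hbK _)) comp1m.
  by rewrite assocK.
rewrite hb_hexagon -!mcompA (reassoc (esym (rw_comp Z _ _))) hbVK tensm_id comp1m.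
by rewrite (reassoc (assocVK _ _ _)) comp1m -lw_comp hbVK tensm_id.
Qed.

Lemma act2K Y Z (s : Mor C (X ⊗ Y) (Z ⊗ X)) (t : Mor C (Z ⊗ X) (X ⊗ Y)) A :
  t ∘ s = id_mor _ -> act2 t A ∘ act2 s A = id_mor _.
Proof. by move=> K; rewrite -act2_comp K act2_id. Qed.

Lemma hb_slide Y Y' (f : Mor C Y Y') A :
  act2 (hb σ Y') A ∘ X ◁ (f ▷ A) = f ▷ (X ⊗ A) ∘ act2 (hb σ Y) A.
Proof. by rewrite -act2_lw -act2_rw -!act2_comp hb_natural. Qed.

Lemma hb_tensor Y Z A :
  α Y Z (X ⊗ A) ∘ act2 (hb σ (Y ⊗ Z)) A
  = Y ◁ act2 (hb σ Z) A ∘ act2 (hb σ Y) (Z ⊗ A) ∘ X ◁ α Y Z A.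
Proof.
rewrite /act2 -!lock !lw_comp -!mcompA pentagon_lwVl -!mcompA.
rewrite (reassoc (esym (assoc_natural1 _ _ _))) -!mcompA.
rewrite (reassoc (pentagon_lwVr _ _ _ _)) -!mcompA.
rewrite (reassoc (assocK _ _ _)) comp1m.
rewrite (reassoc (esym (assoc_natural _ _ _ _))) -!mcompA.
rewrite (mcompA (α Y Z _)) -pentagon -!mcompA; do 2!congr (_ ∘ _).
rewrite !mcompA -!rw_comp; congr (_ ▷ A ∘ _).
by rewrite -hb_hexagon -!mcompA assocVK compm1.
Qed.

(** The hexagon makes the braiding with the unit object idempotent, up to unit
    constraints, and an invertible idempotent is an identity. *)
Lemma hb_unit A : λ (X ⊗ A) ∘ act2 (hb σ I) A = X ◁ λ A.
Proof.
have E : λ (X ⊗ (I ⊗ A)) ∘ act2 (hb σ I) (I ⊗ A) = X ◁ λ (I ⊗ A).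
  apply: (cancel_left (act2K A (hbK I))).
  have K : X ◁ α I I A ∘ X ◁ α' I I A = id_mor _.
    by rewrite -lw_comp assocVK tensm_id.
  apply: (cancel_right K); rewrite -!mcompA -lw_comp lunit_tensor hb_slide.
  rewrite -lunit_tensor -mcompA hb_tensor -!mcompA.
  by rewrite (reassoc (lunit_natural M _)) -!mcompA.
have K : X ◁ I ◁ λ A ∘ X ◁ I ◁ λ' A = id_mor _.
  by rewrite -!lw_comp lunitVK !tensm_id.
apply: (cancel_right K); rewrite -mcompA act2_natural mcompA lunit_natural.
by rewrite -mcompA E -!lw_comp lunit_natural.
Qed.

Lemma hb_tensor2 Y Z A :
  Y ◁ act2 (hb σ Z) A ∘ act2 (hb σ Y) (Z ⊗ A)
  = α Y Z (X ⊗ A) ∘ act2 (hb σ (Y ⊗ Z)) A ∘ X ◁ α' Y Z A.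
Proof. by rewrite hb_tensor -!mcompA -lw_comp assocVK tensm_id compm1. Qed.

(** Crossing both legs of a bend amounts to crossing the unit object, which is
    trivial. *)
Lemma hb_cap Y Z (φ : Mor C (Y ⊗ Z) I) A :
  cap φ (X ⊗ A) ∘ Y ◁ act2 (hb σ Z) A ∘ act2 (hb σ Y) (Z ⊗ A) = X ◁ cap φ A.
Proof.
rewrite -mcompA hb_tensor2 /cap -!lock -!mcompA (reassoc (assocK _ _ _)) comp1m.
by rewrite (reassoc (esym (hb_slide _ _))) -!mcompA (reassoc (hb_unit _)) !lw_comp !mcompA.
Qed.

Lemma hb_cup Y Z (ψ : Mor C I (Y ⊗ Z)) A :
  Y ◁ act2 (hb σ Z) A ∘ act2 (hb σ Y) (Z ⊗ A) ∘ X ◁ cup ψ A = cup ψ (X ⊗ A).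
Proof.
have K : X ◁ α' Y Z A ∘ X ◁ α Y Z A = id_mor _.
  by rewrite -lw_comp assocK tensm_id.
rewrite hb_tensor2 /cup -!lock !lw_comp -!mcompA (reassoc K) comp1m.
rewrite (reassoc (hb_slide _ _)) -!mcompA; do 2!congr (_ ∘ _).
apply: (cancel_left (lunitK _)); rewrite (reassoc (hb_unit _)) lunitVK.
by rewrite -lw_comp lunitVK tensm_id.
Qed.

(** When [f] is a crossing this is the Yang-Baxter equation. *)
Lemma hb_act2 Y Z Y' Z' (f : Mor C (Y ⊗ Z) (Y' ⊗ Z')) A :
  Y' ◁ act2 (hb σ Z') A ∘ act2 (hb σ Y') (Z' ⊗ A) ∘ X ◁ act2 f A
  = act2 f (X ⊗ A) ∘ Y ◁ act2 (hb σ Z) A ∘ act2 (hb σ Y) (Z ⊗ A).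
Proof.
have K : X ◁ α' Y' Z' A ∘ X ◁ α Y' Z' A = id_mor _.
  by rewrite -lw_comp assocK tensm_id.
rewrite -[in RHS]mcompA !hb_tensor2 /(act2 f) -!lock !lw_comp -!mcompA.
rewrite (reassoc K) comp1m (reassoc (hb_slide _ _)) -!mcompA.
by rewrite [in RHS](reassoc (assocK _ _ _)) comp1m.
Qed.

Definition carry Y E (v : Mor C I (Y ⊗ E)) A :
    Mor C (X ⊗ A) (Y ⊗ (X ⊗ (E ⊗ A))) :=
  locked (act2 (hb σ Y) (E ⊗ A) ∘ X ◁ cup v A).

Lemma carryE Y E (v : Mor C I (Y ⊗ E)) A :
  carry v A = act2 (hb σ Y) (E ⊗ A) ∘ X ◁ cup v A.
Proof. by rewrite /carry -lock. Qed.

Lemma carry_rw Y E (v : Mor C I (Y ⊗ E)) A :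
  carry v A
  = α Y X (E ⊗ A) ∘ α (Y ⊗ X) E A ∘ (hb σ Y ▷ E ∘ α' X Y E ∘ X ◁ v ∘ ρ' X) ▷ A.
Proof.
rewrite carryE /act2 -lock -!mcompA lw_cup (reassoc (esym (assoc_natural1 _ _ _))).
by rewrite !rw_comp -!mcompA.
Qed.

Lemma carry_rwl Y Y' E (f : Mor C Y Y') (v : Mor C I (Y ⊗ E)) A :
  carry (f ▷ E ∘ v) A = f ▷ (X ⊗ (E ⊗ A)) ∘ carry v A.
Proof.
by rewrite !carryE act2_cup act2_rw lw_comp mcompA hb_slide -mcompA.
Qed.

Lemma carry_lwl Y E E' (w : Mor C E E') (v : Mor C I (Y ⊗ E)) A :
  carry (Y ◁ w ∘ v) A = Y ◁ X ◁ (w ▷ A) ∘ carry v A.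
Proof.
by rewrite !carryE act2_cup act2_lw lw_comp mcompA act2_natural -mcompA.
Qed.

(** By the hexagon, [X] crosses two nested bends one after the other; this makes
    the masses defined below multiplicative. *)
Lemma carry_nest Y E Y' E' (v : Mor C I (Y ⊗ E)) (v' : Mor C I (Y' ⊗ E')) A :
  carry (nest_coev v v') A
  = α' Y Y' (X ⊗ ((E' ⊗ E) ⊗ A)) ∘ Y ◁ Y' ◁ X ◁ α' E' E A
    ∘ Y ◁ carry v' (E ⊗ A) ∘ carry v A.
Proof.
have K : X ◁ α Y Y' ((E' ⊗ E) ⊗ A) ∘ X ◁ α' Y Y' ((E' ⊗ E) ⊗ A) = id_mor _.
  by rewrite -lw_comp assocVK tensm_id.
apply: (cancel_left (assocK Y Y' _)).
rewrite !carryE cup_nest -!mcompA (reassoc (hb_tensor _ _ _)) -!mcompA.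
rewrite !lw_comp -!mcompA (reassoc K) comp1m.
rewrite (reassoc (assocVK _ _ _)) comp1m.
rewrite (reassoc (act2_natural _ _)) -!mcompA.
rewrite (reassoc (act2_natural _ _)) -!mcompA.
by rewrite (reassoc (esym (lw_comp Y _ _))) act2_natural lw_comp -!mcompA.
Qed.

End HalfBraiding.

(** Because of the dual, every crossing is recovered from the strands that start
    at the coevaluation. *)
Lemma carry_inj X (σ τ : half_braiding X) Y D (ev : Mor C (D ⊗ Y) I)
    (coev : Mor C I (Y ⊗ D)) :
  zig coev ev = id_mor Y ->
  (forall A, carry σ coev A = carry τ coev A) -> hb σ Y = hb τ Y.
Proof.
move=> Z1 E.
have K (s : Mor C (X ⊗ Y) (Y ⊗ X)) A :
    act2 s A = Y ◁ X ◁ cap ev A ∘ (act2 s (D ⊗ (Y ⊗ A)) ∘ X ◁ cup coev (Y ⊗ A)).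
  rewrite (reassoc (esym (act2_natural _ _))) -mcompA -lw_comp -zig_rw Z1.
  by rewrite !tensm_id compm1.
have {}E A : act2 (hb σ Y) A = act2 (hb τ Y) A.
  by rewrite K [RHS]K -!carryE E.
apply: rw_inj => A; apply: (cancel_left (assocK _ _ _)).
apply: (cancel_right (assocK _ _ _)).
by have := E A; rewrite /act2 -!lock.
Qed.

(** * Braidings *)

Section Braided.
Variable c : braiding M.

Lemma braidK X Y : braidV c X Y ∘ c X Y = id_mor _.
Proof. by case: (braid_inverse c X Y). Qed.

Lemma braidVK X Y : c X Y ∘ braidV c X Y = id_mor _.
Proof. by case: (braid_inverse c X Y). Qed.

Lemma braidV_natural X X' Y Y' (f : Mor C X X') (g : Mor C Y Y') :
  braidV c X' Y' ∘ (g ⊗₁ f) = (f ⊗₁ g) ∘ braidV c X Y.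
Proof.
apply: (cancel_left (braidK _ _)); rewrite mcompA braidVK comp1m.
by rewrite mcompA braid_natural -mcompA braidVK compm1.
Qed.

Definition braid_over X : half_braiding X.
Proof.
exists (fun Y => c X Y) (fun Y => braidV c X Y) => [Y|Y Y' f|Y Z].
- exact: braid_inverse.
- exact: braid_natural.
- exact: hexagon_right.
Defined.

Definition braid_under X : half_braiding X.
Proof.
exists (fun Y => braidV c Y X) (fun Y => c Y X) => [Y|Y Y' f|Y Z].
- by split; [exact: braidVK | exact: braidK].
- exact: braidV_natural.
have K : (c Y X ▷ Z) ∘ (braidV c Y X ▷ Z) = id_mor _.
  by rewrite -rw_comp braidVK tensm_id.
have K' : Y ◁ braidV c Z X ∘ Y ◁ c Z X = id_mor _.
  by rewrite -lw_comp braidK tensm_id.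
have := hexagon_left c Y Z X => E.
apply: (cancel_right (assocK X Y Z)); rewrite -!mcompA assocVK compm1.
apply: (cancel_right (braidVK (Y ⊗ Z) X)); rewrite -!mcompA braidK compm1.
apply: (cancel_right (assocK Y Z X)); rewrite assocVK -!mcompA.
move: E; rewrite -!mcompA => ->.
rewrite [RHS](_ : _ = Y ◁ braidV c Z X ∘ (α Y X Z ∘ ((braidV c Y X ▷ Z ∘ (c Y X ▷ Z))
  ∘ (α' Y X Z ∘ Y ◁ c Z X)))); last by rewrite -!mcompA.
by rewrite -rw_comp braidK tensm_id comp1m (reassoc (assocVK _ _ _)) comp1m K'.
Defined.

Lemma braid_tensor_left X Y Z A :
  Z ◁ α X Y A ∘ act2 (c (X ⊗ Y) Z) A
  = act2 (c X Z) (Y ⊗ A) ∘ X ◁ act2 (c Y Z) A ∘ α X Y (Z ⊗ A).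
Proof.
have K1 W B : act2 (braidV c W Z) B ∘ act2 (c W Z) B = id_mor _.
  by rewrite -act2_comp braidK act2_id.
have K2 W B : act2 (c W Z) B ∘ act2 (braidV c W Z) B = id_mor _.
  by rewrite -act2_comp braidVK act2_id.
apply: (cancel_right (K1 (X ⊗ Y) A)); rewrite -!mcompA K2 compm1.
rewrite (hb_tensor (braid_under Z) X Y A) -!mcompA.
rewrite (reassoc (esym (lw_comp _ _ _))) K2 tensm_id comp1m.
by rewrite (reassoc (K2 _ _)) comp1m.
Qed.

(** A strand [D] is slid through the cup by crossings of one sign; the
    Yang-Baxter equation then brings two opposite crossings together, they
    cancel, and the strand slides off the cap. *)
Lemma braided_zig X D (ev : Mor C (D ⊗ X) I) (coev : Mor C I (X ⊗ D)) :
  zag ev coev = id_mor D ->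
  zig (braidV c D X ∘ coev) (ev ∘ c X D) = id_mor D.
Proof.
move=> Z2; apply: rw_inj => A; rewrite zig_rw cap_act2 act2_cup lw_comp -!mcompA.
rewrite -(hb_cup (braid_under D)) -!mcompA.
have := hb_act2 (braid_under D) (braidV c D X) A; rewrite -!mcompA /= => E.
rewrite /= (reassoc3 (esym E)) -!mcompA.
have K : D ◁ act2 (c X D) A ∘ D ◁ act2 (braidV c X D) A = id_mor _.
  by rewrite -lw_comp -act2_comp braidVK act2_id tensm_id.
rewrite (reassoc K) comp1m.
rewrite -(hb_cap (braid_over D)) -!mcompA /=.
have K' : act2 (c D D) (X ⊗ A) ∘ act2 (braidV c D D) (X ⊗ A) = id_mor _.
  by rewrite -act2_comp braidVK act2_id.
have K'' : D ◁ act2 (c D X) A ∘ D ◁ act2 (braidV c D X) A = id_mor _.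
  by rewrite -lw_comp -act2_comp braidVK act2_id tensm_id.
by rewrite (reassoc K') comp1m (reassoc K'') comp1m -zag_rw Z2.
Qed.

(** The crossing of [X ⊗ Y] with [E ⊗ D] also crosses [X] with [E] and [Y] with
    [D].  The Yang-Baxter equation and the double braiding rearrange these into
    strands that cross both legs of a bend, off which they slide. *)
Lemma nest_ev_braid X Y D E (ev : Mor C (D ⊗ X) I) (ev' : Mor C (E ⊗ Y) I) :
  nest_ev (ev' ∘ c Y E) (ev ∘ c X D)
  = nest_ev ev ev' ∘ c (X ⊗ Y) (E ⊗ D) ∘ (c Y X ∘ c X Y) ▷ (E ⊗ D).
Proof.
rewrite -mcompA braid_natural mcompA; apply: cap_inj => A.
rewrite cap_act2 cap_act2 act2_lw !cap_nest !cap_act2 -!mcompA.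
rewrite (reassoc (assoc_natural3 _ _ _)) -!mcompA.
rewrite (hb_tensor (braid_over (X ⊗ Y)) E D A) /= -!mcompA.
have T (s : Mor C (X ⊗ Y) (X ⊗ Y)) : α X Y A ∘ (s ▷ A) = act2 s A ∘ α X Y A.
  by rewrite /act2 -lock -!mcompA assocK compm1.
have -> B (h : Mor C B (E ⊗ ((X ⊗ Y) ⊗ (D ⊗ A)))) :
     E ◁ D ◁ α X Y A ∘ (E ◁ D ◁ ((c Y X ∘ c X Y) ▷ A) ∘ (E ◁ act2 (c (X ⊗ Y) D) A ∘ h))
   = E ◁ (D ◁ act2 (c Y X) A ∘ (D ◁ act2 (c X Y) A ∘
        (act2 (c X D) (Y ⊗ A) ∘ (X ◁ act2 (c Y D) A ∘ α X Y (D ⊗ A))))) ∘ h.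
  rewrite !mcompA -!lw_comp -!mcompA; congr (E ◁ _ ∘ h).
  rewrite T act2_comp !lw_comp -!mcompA.
  by rewrite braid_tensor_left -!mcompA.
have H := hb_act2 (braid_over X) (c Y D) A; rewrite /= -!mcompA in H.
rewrite (reassoc3 H) -!mcompA.
have H' := hb_cap (braid_over Y) ev A; rewrite /= -!mcompA in H'.
rewrite (reassoc (esym (lw_comp E _ _))) [cap ev (Y ⊗ A) ∘ _](_ : _ =
   Y ◁ (cap ev A ∘ act2 (c X D) A) ∘ (act2 (c X Y) (D ⊗ A) ∘ α X Y (D ⊗ A))); last first.
  by rewrite !mcompA -(mcompA (cap ev _)) H' -lw_comp.
rewrite !lw_comp -!mcompA (reassoc (cap_natural _ _)) -!mcompA.
rewrite (reassoc (cap_natural _ _)) -!mcompA.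
rewrite (reassoc (braid_tensor_left _ _ _ _)) -!mcompA.
have H2 := hb_cap (braid_over X) ev' (D ⊗ A); rewrite /= -!mcompA in H2.
by rewrite (reassoc3 H2) assoc_natural3.
Qed.
End Braided.

End Calculus.

(** * Schur's lemma *)

Section Schur.
Variables (R : realType) (C : linear_category R).
Implicit Types X Y : C.

(** The form in which simplicity is used; it passes at once to duals and along
    isomorphisms. *)
Definition brick X : Prop := forall f : Mor C X X, exists a, f = a *: id_mor X.

Lemma zero_object_id0 X : id_mor X = 0 -> zero_object X.
Proof.
by move=> E Y; split=> f; [rewrite -(comp1m f) E comp0m|rewrite -(compm1 f) E compm0].
Qed.

Lemma simple_id_neq0 X : simple_object X -> id_mor X != 0.
Proof. by move=> [nz _]; apply/eqP => /zero_object_id0. Qed.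

Lemma id_iso X : is_iso (id_mor X).
Proof. by exists (id_mor X); split; rewrite comp1m. Qed.

Lemma comp_iso X Y Z (g : Mor C Y Z) (f : Mor C X Y) :
  is_iso g -> is_iso f -> is_iso (g ∘ f).
Proof.
move=> [g' [gK gV]] [f' [fK fV]]; exists (f' ∘ g'); split; rewrite -!mcompA.
  by rewrite (reassoc gK) comp1m.
by rewrite (reassoc fV) comp1m.
Qed.

(** Powers of [f] satisfy a polynomial relation because [End X] is finite
    dimensional; over an algebraically closed field that polynomial splits, and
    if no factor [f - a] were singular, the product would not vanish. *)
Lemma exists_eigenvalue X (f : Mor C X X) :
  finite_dimensional_homs C -> id_mor X != 0 ->
  exists a, ~ is_iso (f - a *: id_mor X).
Proof.
move=> fin nz; apply/existsNP => allI.
have {fin}[n [e eP]] := fin X X.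
pose pw i := iter i (fun g => f ∘ g) (id_mor X).
pose ev (q : {poly R[i]}) N := \sum_(i < N) q`_i *: pw i.
have ev_iso (r : seq R[i]) N : (size r < N)%N ->
    is_iso (ev (\prod_(z <- r) ('X - z%:P)) N).
  elim: r N => [|z r IHr] [//|N] ltN.
    rewrite big_nil /ev big_ord_recl big1 => [|i _].
      by rewrite coef1 scale1r addr0; apply: id_iso.
    by rewrite coef1 scale0r.
  rewrite big_cons; set q := \prod_(z <- r) _.
  suff -> : ev (('X - z%:P) * q) N.+1 = (f - z *: id_mor X) ∘ ev q N.
    exact: comp_iso (allI z) (IHr _ _).
  have q0 : q`_N = 0 by apply: nth_default; rewrite size_prod_XsubC.
  have evS : ev q N.+1 = ev q N by rewrite /ev big_ord_recr /= q0 scale0r addr0.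
  transitivity (ev ('X * q) N.+1 - z *: ev q N.+1).
    rewrite /ev scaler_sumr -sumrB; apply: eq_bigr => i _.
    by rewrite mulrBl coefB coefCM scalerBl scalerA.
  rewrite evS compDl compNl compZl comp1m; congr (_ - _).
  rewrite /ev big_ord_recl coefXM /= scale0r add0r comp_sumr.
  by apply: eq_bigr => i _; rewrite coefXM compZr.
have /choice[a aP] : forall i, exists a : 'I_n -> R[i], pw i = \sum_k a k *: e k.
  by move=> i; apply: eP.
pose A := \matrix_(i < n.+1, k < n) a i k.
pose u := nz_row (kermx A).
have u0 : u != 0.
  rewrite nz_row_eq0 -mxrank_eq0 mxrank_ker subn_eq0 -ltnNge ltnS.
  exact: rank_leq_col.
have uA : u *m A = 0 by apply/sub_kermxP; exact: nz_row_sub.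
pose p := rVpoly u.
have p0 : p != 0.
  by apply: contra u0 => /eqP E; rewrite -[u]rVpolyK -/p E linear0.
have evp : ev p n.+1 = 0.
  transitivity (\sum_(k < n) (u *m A) 0 k *: e k); last first.
    by rewrite uA big1 // => k _; rewrite mxE scale0r.
  rewrite /ev; under eq_bigr do rewrite aP scaler_sumr.
  rewrite exchange_big; apply: eq_bigr => k _; rewrite mxE scaler_suml.
  apply: eq_bigr => i _; rewrite scalerA mxE; congr (_ * _ *: _).
  by rewrite /p coef_rVpoly_ord.
have [r pr] := closed_field_poly_normal p.
have lp0 : lead_coef p != 0 by rewrite lead_coef_eq0.
have szr : (size r < n.+1)%N.
  have := size_poly n.+1 (fun i => if insub i is Some k then u 0 k else 0).
  rewrite -/(rVpoly u) -/p pr size_scale // size_prod_XsubC.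
  by [].
have [g [gK _]] := ev_iso r n.+1 szr.
case/eqP: nz; rewrite -gK.
have -> : ev (\prod_(z <- r) ('X - z%:P)) n.+1 = 0; last by rewrite compm0.
apply: (scalerI lp0); rewrite scaler0 -evp /ev scaler_sumr.
by apply: eq_bigr => i _; rewrite scalerA -coefZ -pr.
Qed.

(** For an eigenvalue [a] of [f], the kernel of [f - a] is nonzero, hence it is
    all of the simple object. *)
Lemma simple_brick X :
  is_abelian C -> finite_dimensional_homs C -> simple_object X -> brick X.
Proof.
move=> ab fin simX f; have nz := simple_id_neq0 simX.
have [a nI] := exists_eigenvalue f fin nz; exists a; apply/subr0_eq.
set g := f - _ in nI *.
have [K [k [gk kU]]] := has_kernels ab g.
have monok : mono k.
  move=> W s t E; have [|u [_ uU]] := kU W (k ∘ s); first by rewrite mcompA gk comp0m.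
  by rewrite -(uU s erefl) (uU t).
have [_ /(_ K k monok)[Z|[k' [_ kV]]]] := simX; last first.
  by rewrite -(compm1 g) -kV mcompA gk comp0m.
have monog : mono g.
  move=> W s t E; apply/subr0_eq.
  have [|u [<- _]] := kU W (s - t); first by rewrite compDr compNr E subrr.
  by rewrite ((Z W).1 u) compm0.
have [nzX /(_ X g monog)[|//]] := simX.
by move/(_ X) => [/(_ (id_mor X)) E _]; rewrite E eqxx in nz.
Qed.

Lemma brick_iso X Y : isomorphic X Y -> brick Y -> brick X.
Proof.
move=> [u [u' [uK uV]]] bY f; have [a E] := bY (u ∘ f ∘ u'); exists a.
apply: (cancel_left uK); apply: (cancel_right uK).
by rewrite E compZr compm1 compZl uV.
Qed.

End Schur.

(** * Adjoints *)

Section Unitary.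
Variables (R : realType) (C : unitary_fusion_category R).
Implicit Types X Y Z W A B D E : C.

Local Notation M := (ufc_monoidal C).
Local Notation I := (unit_ob M).
Local Notation "X ⊗ Y" := (tens M X Y) (at level 39, left associativity).
Local Notation "f ⊗₁ g" := (tensm M f g) (at level 39, left associativity).
Local Notation "X ◁ f" := (tensm M (id_mor X) f) (at level 38, right associativity).
Local Notation "f ▷ X" := (tensm M f (id_mor X)) (at level 39, left associativity).
Local Notation α := (assoc M).
Local Notation α' := (assocV M).
Local Notation λ := (lunit M).
Local Notation λ' := (lunitV M).
Local Notation ρ := (runit M).
Local Notation ρ' := (runitV M).
Local Notation "f ^*" := (star (cstar_star C) f) : ring_scope.

Lemma starD X Y (f g : Mor C X Y) : (f + g)^* = f^* + g^*.
Proof.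
by have := star_antilinear (cstar_star C) 1 f g; rewrite !scale1r rmorph1 scale1r.
Qed.

Lemma star0 X Y : (0 : Mor C X Y)^* = 0.
Proof. by apply: (addrI (0 : Mor C X Y)^*); rewrite -starD !addr0. Qed.

Lemma starZ X Y a (f : Mor C X Y) : (a *: f)^* = Num.conj a *: f^*.
Proof.
by have := star_antilinear (cstar_star C) a f 0; rewrite star0 !addr0.
Qed.

Lemma starN X Y (f : Mor C X Y) : (- f)^* = - f^*.
Proof. by rewrite -[- f]scaleN1r starZ rmorphN1 scaleN1r. Qed.

Lemma star_sum X Y n (f : 'I_n -> Mor C X Y) : (\sum_k f k)^* = \sum_k (f k)^*.
Proof.
by apply: (big_morph (fun g => g^*)) => [f1 f2|]; rewrite ?starD ?star0.
Qed.

Lemma star_eq0 X Y (f : Mor C X Y) : f^* ∘ f = 0 -> f = 0.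
Proof.
move=> E; have := cstar_identity f; rewrite E /mor_norm normr0.
by move=> /esym/eqP; rewrite sqrf_eq0 normr_eq0 => /eqP.
Qed.

(** [a] belongs to the spectrum of the positive morphism. *)
Lemma star_ge0 X Y (f : Mor C X Y) (a : R[i]) :
  id_mor X != 0 -> f^* ∘ f = a *: id_mor X -> 0 <= a.
Proof.
move=> nz E; have [_ ->//] := cstar_positive f.
rewrite /spectrum /= E subrr => -[g [gK _]].
by rewrite -gK compm0 eqxx in nz.
Qed.

Lemma brick_norm X Y (f : Mor C X Y) :
  brick X -> exists2 a : R[i], 0 <= a & f^* ∘ f = a *: id_mor X.
Proof.
move=> bX; have [E|nz] := eqVneq (id_mor X) 0.
  exists 0 => //; rewrite scale0r -[LHS]compm1 E compm0 //.
by have [a aE] := bX (f^* ∘ f); exists a => //; apply: star_ge0 aE.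
Qed.

Lemma star_assoc X Y Z : (α X Y Z)^* = α' X Y Z.
Proof.
have [_ K] := ufc_assoc_unitary X Y Z.
by apply: inverse_unique K (assocVK M X Y Z).
Qed.

Lemma star_lunit X : (λ X)^* = λ' X.
Proof.
have [_ K] := ufc_lunit_unitary X.
by apply: inverse_unique K (lunitVK M X).
Qed.

Lemma star_runit X : (ρ X)^* = ρ' X.
Proof.
have [_ K] := ufc_runit_unitary X.
by apply: inverse_unique K (runitVK M X).
Qed.

Lemma star_assocV X Y Z : (α' X Y Z)^* = α X Y Z.
Proof. by rewrite -star_assoc starK. Qed.

Lemma star_lunitV X : (λ' X)^* = λ X.
Proof. by rewrite -star_lunit starK. Qed.

Lemma star_lw X A B (f : Mor C A B) : (X ◁ f)^* = X ◁ f^*.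
Proof. by rewrite ufc_star_tensm star_id. Qed.

Lemma star_rw X Y A (f : Mor C X Y) : (f ▷ A)^* = f^* ▷ A.
Proof. by rewrite ufc_star_tensm star_id. Qed.

Lemma star_cap X Y (φ : Mor C (X ⊗ Y) I) A : (cap φ A)^* = cup φ^* A.
Proof.
by rewrite capE cupE !star_comp star_rw star_assocV star_lunit mcompA.
Qed.

Lemma star_cup X Y (ψ : Mor C I (X ⊗ Y)) A : (cup ψ A)^* = cap ψ^* A.
Proof. by rewrite -(starK (cstar_star C) ψ) -star_cap !starK. Qed.

Lemma star_act2 X Y X' Y' (s : Mor C (X ⊗ Y) (X' ⊗ Y')) A :
  (act2 s A)^* = act2 s^* A.
Proof.
by rewrite /act2 -!lock !star_comp star_rw star_assocV star_assoc mcompA.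
Qed.

Lemma star_zig X Y D (ψ : Mor C I (X ⊗ D)) (φ : Mor C (D ⊗ Y) I) :
  (zig ψ φ)^* = zag ψ^* φ^*.
Proof.
rewrite /zig /zag -!lock !star_comp star_rw star_lw star_assoc star_runit.
by rewrite star_lunitV !mcompA.
Qed.

Lemma star_zag E Y D (φ : Mor C (E ⊗ Y) I) (ψ : Mor C I (Y ⊗ D)) :
  (zag φ ψ)^* = zig φ^* ψ^*.
Proof. by rewrite -(starK (cstar_star C) φ) -(starK (cstar_star C) ψ) -star_zig !starK. Qed.

(** Taking adjoints exchanges the two zigzag identities. *)
Lemma star_dual X D (ev : Mor C (D ⊗ X) I) (coev : Mor C I (X ⊗ D)) :
  is_dual ev coev -> is_dual (coev^*) (ev^*).
Proof.
move=> /is_dualP[Z1 Z2]; apply/is_dualP.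
by split; [rewrite -star_zag Z2 | rewrite -star_zig Z1]; rewrite star_id.
Qed.

(** * Orthonormal decompositions *)

(** Gram-Schmidt orthonormalisation: the squared length of a vector in
    [Mor (F k) X] is a positive scalar, as [F k] has only scalar endomorphisms. *)
Lemma orthonormalize n (F : 'I_n -> C) X (i : forall k, Mor C (F k) X)
    (p : forall k, Mor C X (F k)) :
  (forall k, brick (F k)) -> (forall k, id_mor (F k) != 0) -> direct_sum i p ->
  exists j : forall k, Mor C (F k) X, direct_sum j (fun k => (j k)^*).
Proof.
move=> bF nzF [pi pi0 ip1].
(* The first [m] vectors are orthonormal and span the first [m] old ones; the
   later [p k] vanish on them, so that [i k0] is not in their span. *)
have GS m : (m <= n)%N -> exists j : forall k, Mor C (F k) X,
  [/\ forall k : 'I_n, (k < m)%N -> (j k)^* ∘ j k = id_mor (F k),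
      forall k l : 'I_n, (k < m)%N -> (l < m)%N -> k != l -> (j k)^* ∘ j l = 0,
      forall k l : 'I_n, (l < m)%N -> (m <= k)%N -> p k ∘ j l = 0
    & forall k : 'I_n, (k < m)%N ->
        (\sum_(l < n | (l < m)%N) j l ∘ (j l)^*) ∘ i k = i k].
  elim: m => [|m IHm] ltmn.
    by exists i; split=> // k.
  have [j [jj jj0 pj ji]] := IHm (ltnW ltmn).
  pose k0 := Ordinal ltmn.
  pose P := \sum_(l < n | (l < m)%N) j l ∘ (j l)^*.
  have PE : P = \sum_(l < n) if (l < m)%N then j l ∘ (j l)^* else 0.
    by rewrite -big_mkcond.
  have jP (l : 'I_n) : (l < m)%N -> (j l)^* ∘ P = (j l)^*.
    move=> lm; rewrite PE comp_sumr (bigD1 l) //= lm mcompA jj // comp1m.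
    rewrite big1 ?addr0 // => k kl; case: ifP => km; last by rewrite compm0.
    by rewrite mcompA jj0 ?comp0m // eq_sym.
  have starP : P^* = P.
    rewrite PE star_sum; apply: eq_bigr => l _.
    by case: ifP => _; rewrite ?star0 // star_comp starK.
  have PP : P ∘ P = P.
    rewrite {1}PE comp_suml PE; apply: eq_bigr => l _.
    by case: ifP => lm; rewrite ?comp0m // -PE -mcompA jP.
  have pP (k : 'I_n) : (m <= k)%N -> p k ∘ P = 0.
    move=> mk; rewrite PE comp_sumr big1 // => l _.
    by case: ifP => lm; rewrite ?compm0 // mcompA pj ?comp0m.
  pose h := i k0 - P ∘ i k0.
  have ph (k : 'I_n) : (m <= k)%N -> p k ∘ h = p k ∘ i k0.
    by move=> mk; rewrite /h compDr compNr mcompA pP // comp0m subr0.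
  have Ph : P ∘ h = 0 by rewrite /h compDr compNr mcompA PP subrr.
  have [a a0 ha] := brick_norm h (bF k0).
  have anz : a != 0.
    apply/eqP => az; have := ph k0 (leqnn _); rewrite pi.
    rewrite (@star_eq0 _ _ h) ?ha ?az ?scale0r // compm0 => /esym/eqP.
    by rewrite (negPf (nzF k0)).
  have sa0 : sqrtC a != 0 by rewrite sqrtC_eq0.
  pose u := (sqrtC a)^-1 *: h.
  have csa : Num.conj (sqrtC a)^-1 = (sqrtC a)^-1.
    by rewrite geC0_conj // invr_ge0 sqrtC_ge0.
  have uu : u^* ∘ u = id_mor _.
    rewrite /u starZ csa compZl compZr ha !scalerA -expr2 exprVn sqrtCK.
    by rewrite mulVf // scale1r.
  have Pu : P ∘ u = 0 by rewrite /u compZr Ph scaler0.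
  have uP : u^* ∘ P = 0 by rewrite -starP -star_comp Pu star0.
  have ju (l : 'I_n) : (l < m)%N -> (j l)^* ∘ u = 0.
    by move=> lm; rewrite -jP // -mcompA Pu compm0.
  have uj (l : 'I_n) : (l < m)%N -> u^* ∘ j l = 0.
    by move=> lm; rewrite -[LHS](starK (cstar_star C)) star_comp starK ju // star0.
  pose j' := @dfwith _ (fun k => Mor C (F k) X) j k0 u.
  have j'0 : j' k0 = u by rewrite /j' dfwithin.
  have j'm (l : 'I_n) : (l < m)%N -> j' l = j l.
    by move=> lm; rewrite /j' dfwithout // -val_eqE /= neq_ltn lm orbT.
  have k0m (l : 'I_n) : (l < m.+1)%N -> l = k0 \/ (l < m)%N.
    by rewrite ltnS leq_eqVlt => /orP[/eqP E|]; [left; apply: val_inj | right].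
  exists j'; split.
  - by move=> k /k0m[->|km]; [rewrite j'0 | rewrite j'm // jj].
  - move=> k l /k0m[->|km] /k0m[->|lm] kl.
    + by rewrite eqxx in kl.
    + by rewrite j'0 j'm // uj.
    + by rewrite j'0 j'm // ju.
    + by rewrite !j'm // jj0.
  - move=> k l /k0m[->|lm] mk; last by rewrite j'm // pj // ltnW.
    rewrite j'0 /u compZr ph ?(ltnW mk) // pi0 ?scaler0 //.
    by rewrite -val_eqE /= neq_ltn mk orbT.
  have -> : \sum_(l < n | (l < m.+1)%N) j' l ∘ (j' l)^* = P + u ∘ u^*.
    rewrite (bigD1 k0) //= j'0 addrC; congr (_ + _).
    rewrite /P; apply: eq_big => [l|l].
      rewrite -val_eqE /= ltnS andbC [RHS]ltn_neqAle; by [].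
    by move=> /andP[/k0m[->|lm]]; rewrite ?eqxx // j'm.
  move=> k /k0m[->|km]; rewrite compDl.
    suff E : u ∘ u^* ∘ i k0 = h by rewrite E /h addrC subrK.
    rewrite (_ : i k0 = h + P ∘ i k0); last by rewrite /h subrK.
    rewrite -mcompA compDr (mcompA _ P) uP comp0m addr0.
    rewrite /u starZ csa !compZl ha !compZr !scalerA compm1.
    by rewrite -expr2 exprVn sqrtCK mulVf // scale1r.
  by rewrite ji // -[i k]ji // -/P !mcompA -(mcompA u) uP compm0 comp0m addr0.
have [j [jj jj0 _ ji]] := GS n (leqnn n).
exists j; split=> [k|k l|]; [exact: jj | exact: jj0 |].
rewrite -(compm1 (\sum_k _)) -ip1 comp_sumr; apply: eq_bigr => k _.
rewrite mcompA; congr (_ ∘ _); rewrite -[RHS]ji //; congr (_ ∘ _).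
by apply: eq_bigl => l; rewrite ltn_ord.
Qed.

Lemma ufc_brick X : simple_object X -> brick X.
Proof.
have F := ufc_fusion C.
by apply: simple_brick; [apply: fusion_abelian F | apply: fusion_hom_finite F].
Qed.

Lemma orthonormal_simples X : exists n (F : 'I_n -> C) (j : forall k, Mor C (F k) X),
  (forall k, simple_object (F k)) /\ direct_sum j (fun k => (j k)^*).
Proof.
have [n [F [i [p [sF ds]]]]] := fusion_semisimple (ufc_fusion C) X.
have [k|k|j jP] := orthonormalize _ _ ds.
- exact: ufc_brick.
- exact: simple_id_neq0.
by exists n, F, j.
Qed.

Lemma scale_id_inj X (a b : R[i]) :
  id_mor X != 0 -> a *: id_mor X = b *: id_mor X -> a = b.
Proof.
move=> nz /eqP; rewrite -subr_eq0 -scalerBl scaler_eq0 (negPf nz) orbF subr_eq0.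
by move/eqP.
Qed.

Lemma tens_unit_neq0 X : id_mor X != 0 -> id_mor (X ⊗ I) != 0.
Proof.
apply: contra => /eqP E; apply/eqP; rewrite -(runitVK M X) -(compm1 (ρ X)) E.
by rewrite compm0 comp0m.
Qed.

(** * Unitarity of the braiding *)

(** Unitarity of [σ] means that this half-braiding is [σ] itself. *)
Definition adjoint_hb X (σ : half_braiding M X) : half_braiding M X.
Proof.
exists (fun Y => (hbV σ Y)^*) (fun Y => (hb σ Y)^*) => [Y|Y Y' f|Y Z].
- by split; rewrite -star_comp ?hbK ?hbVK star_id.
- rewrite -{1}(starK (cstar_star C) f) -{2}(starK (cstar_star C) f).
  by rewrite -star_lw -star_rw -!star_comp hbV_natural.
rewrite -{1}star_assocV -{1}star_assocV -(star_assocV Y X Z) -star_lw -star_rw.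
by rewrite -!star_comp !mcompA hbV_hexagon.
Defined.

Lemma unit_brick : brick I.
Proof. exact/ufc_brick/(fusion_unit_simple (ufc_fusion C)). Qed.

Lemma unit_neq0 : id_mor I != 0.
Proof. exact/simple_id_neq0/(fusion_unit_simple (ufc_fusion C)). Qed.

(** Squared lengths of [v], before and after [X] is carried across its first
    strand.  They are scalars because the unit object and [X] have only scalar
    endomorphisms. *)
Definition cup_mass Y E (v : Mor C I (Y ⊗ E)) (n : R[i]) : Prop :=
  forall A, (cup v A)^* ∘ cup v A = n *: id_mor A.

Definition carry_mass X (σ : half_braiding M X) Y E (v : Mor C I (Y ⊗ E)) (m : R[i]) :
    Prop :=
  forall A, (carry σ v A)^* ∘ carry σ v A = m *: id_mor (X ⊗ A).

Lemma cup_mass_ex Y E (v : Mor C I (Y ⊗ E)) : exists2 n : R[i], 0 <= n & cup_mass v n.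
Proof.
have [n n0 nE] := brick_norm v unit_brick; exists n => // A.
rewrite star_cup capE cupE -!mcompA (reassoc (assocK _ _ _ _)) comp1m.
rewrite (reassoc (esym (rw_comp _ _ _ _))) nE tensmZl tensm_id compZl comp1m compZr.
by rewrite lunitVK.
Qed.

Lemma carry_mass_ex X (σ : half_braiding M X) Y E (v : Mor C I (Y ⊗ E)) :
  brick X -> exists2 m : R[i], 0 <= m & carry_mass σ v m.
Proof.
move=> bX; set g := hb σ Y ▷ E ∘ α' X Y E ∘ X ◁ v ∘ ρ' X.
have [m m0 mE] := brick_norm g bX; exists m => // A.
rewrite carry_rw -/g !star_comp !star_assoc star_rw -!mcompA.
rewrite (reassoc (assocK _ _ _ _)) comp1m (reassoc (assocK _ _ _ _)) comp1m.
by rewrite -rw_comp mE tensmZl tensm_id.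
Qed.

Lemma cup_mass_uniq Y E (v : Mor C I (Y ⊗ E)) n n' :
  cup_mass v n -> cup_mass v n' -> n = n'.
Proof.
by move=> N N'; apply: (scale_id_inj unit_neq0); rewrite -N N'.
Qed.

Lemma carry_mass_uniq X (σ : half_braiding M X) Y E (v : Mor C I (Y ⊗ E)) m m' :
  id_mor X != 0 -> carry_mass σ v m -> carry_mass σ v m' -> m = m'.
Proof.
move=> /tens_unit_neq0 nz N N'.
by apply: (scale_id_inj nz); rewrite -N N'.
Qed.

Lemma cup_mass_nest Y E Y' E' (v : Mor C I (Y ⊗ E)) (v' : Mor C I (Y' ⊗ E')) n n' :
  cup_mass v n -> cup_mass v' n' -> cup_mass (nest_coev v v') (n' * n).
Proof.
move=> N N' A; rewrite cup_nest !star_comp star_assocV !star_lw star_assocV -!mcompA.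
rewrite (reassoc (assocVK _ _ _ _)) comp1m.
have K : Y ◁ Y' ◁ α E' E A ∘ Y ◁ Y' ◁ α' E' E A = id_mor _.
  by rewrite -!lw_comp assocVK !tensm_id.
rewrite (reassoc K) comp1m (reassoc (esym (lw_comp _ Y _ _))) N' tensmZr tensm_id.
by rewrite compZl comp1m compZr N scalerA.
Qed.

Lemma carry_mass_nest X (σ : half_braiding M X) Y E Y' E' (v : Mor C I (Y ⊗ E))
    (v' : Mor C I (Y' ⊗ E')) m m' :
  carry_mass σ v m -> carry_mass σ v' m' -> carry_mass σ (nest_coev v v') (m' * m).
Proof.
move=> N N' A; rewrite carry_nest !star_comp star_assocV !star_lw star_assocV -!mcompA.
rewrite (reassoc (assocVK _ _ _ _)) comp1m.
have K : Y ◁ Y' ◁ X ◁ α E' E A ∘ Y ◁ Y' ◁ X ◁ α' E' E A = id_mor _.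
  by rewrite -!lw_comp assocVK !tensm_id.
rewrite (reassoc K) comp1m (reassoc (esym (lw_comp _ Y _ _))) N' tensmZr tensm_id.
by rewrite compZl comp1m compZr N scalerA.
Qed.

Lemma cup_mass_factor Y Y' E E' (u : Mor C Y Y') (w : Mor C E E')
    (v : Mor C I (Y ⊗ E)) (s t n : R[i]) :
  u^* ∘ u = s *: id_mor Y -> w^* ∘ w = t *: id_mor E ->
  cup_mass v n -> cup_mass (u ▷ E' ∘ (Y ◁ w ∘ v)) (s * (t * n)).
Proof.
move=> uE wE N A; rewrite !act2_cup act2_rw act2_lw !star_comp star_rw star_lw star_rw.
rewrite -!mcompA (reassoc (esym (rw_comp _ _ _ _))) uE tensmZl tensm_id compZl comp1m.
rewrite !compZr (reassoc (esym (lw_comp _ _ _ _))) -rw_comp wE tensmZl tensm_id tensmZr.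
by rewrite tensm_id compZl comp1m compZr N !scalerA ?mulrA.
Qed.

Lemma carry_mass_factor X (σ : half_braiding M X) Y Y' E E' (u : Mor C Y Y')
    (w : Mor C E E') (v : Mor C I (Y ⊗ E)) (s t m : R[i]) :
  u^* ∘ u = s *: id_mor Y -> w^* ∘ w = t *: id_mor E ->
  carry_mass σ v m -> carry_mass σ (u ▷ E' ∘ (Y ◁ w ∘ v)) (s * (t * m)).
Proof.
move=> uE wE N A; rewrite carry_rwl carry_lwl !star_comp star_rw !star_lw star_rw.
rewrite -!mcompA (reassoc (esym (rw_comp _ _ _ _))) uE tensmZl tensm_id compZl comp1m.
rewrite !compZr (reassoc (esym (lw_comp _ _ _ _))) -lw_comp -rw_comp wE tensmZl tensm_id.
by rewrite !tensmZr !tensm_id compZl comp1m compZr N !scalerA ?mulrA.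
Qed.

Lemma cup_mass_sum n (F : 'I_n -> C) Y E (j : forall k, Mor C (F k) Y)
    (v : Mor C I (Y ⊗ E)) (N : 'I_n -> R[i]) :
  direct_sum j (fun k => (j k)^*) ->
  (forall k, cup_mass ((j k)^* ▷ E ∘ v) (N k)) -> cup_mass v (\sum_k N k).
Proof.
move=> [_ _ jj] mN A; rewrite scaler_suml.
under eq_bigr => k _.
  rewrite -mN act2_cup act2_rw star_comp star_rw starK -!mcompA.
  rewrite (reassoc (esym (rw_comp _ _ _ _))); over.
by rewrite -comp_sumr -comp_suml -tensm_suml jj tensm_id comp1m.
Qed.

Lemma carry_mass_sum X (σ : half_braiding M X) n (F : 'I_n -> C) Y E
    (j : forall k, Mor C (F k) Y) (v : Mor C I (Y ⊗ E)) (m : 'I_n -> R[i]) :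
  direct_sum j (fun k => (j k)^*) ->
  (forall k, carry_mass σ ((j k)^* ▷ E ∘ v) (m k)) -> carry_mass σ v (\sum_k m k).
Proof.
move=> [_ _ jj] mN A; rewrite scaler_suml.
under eq_bigr => k _.
  rewrite -mN carry_rwl star_comp star_rw starK -!mcompA.
  rewrite (reassoc (esym (rw_comp _ _ _ _))); over.
by rewrite -comp_sumr -comp_suml -tensm_suml jj tensm_id comp1m.
Qed.

Lemma dual_brick X D (ev : Mor C (D ⊗ X) I) (coev : Mor C I (X ⊗ D)) :
  is_dual ev coev -> brick X -> brick D.
Proof.
move=> /is_dualP[_ Z2] bX d; have [a aE] := bX (zig coev (ev ∘ d ▷ X)); exists a.
have := zig_yank_ev (ev ∘ d ▷ X) Z2; rewrite aE tensmZr tensm_id compZr compm1.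
move=> E; rewrite -(comp1m d) -Z2 -zag_compr -E.
by rewrite -[ev in LHS]compm1 -tensm_id -compZr -tensmZl zag_compr Z2 comp1m.
Qed.

(** The bound is homogeneous in [v], additive over an orthonormal decomposition
    of [Y], and on a simple object every [v] is a rescaled coevaluation. *)
Lemma mass_bound X (σ : half_braiding M X) (r : R[i]) n (F : 'I_n -> C)
    (D : 'I_n -> C) (ev : forall k, Mor C (D k ⊗ F k) I)
    (coev : forall k, Mor C I (F k ⊗ D k)) (m0 n0 : 'I_n -> R[i]) :
  brick X -> id_mor X != 0 ->
  (forall Y, simple_object Y -> exists k, isomorphic Y (F k)) ->
  (forall k, is_dual (ev k) (coev k)) ->
  (forall k, carry_mass σ (coev k) (m0 k)) -> (forall k, cup_mass (coev k) (n0 k)) ->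
  (forall k, m0 k <= r * n0 k) ->
  forall Y E (v : Mor C I (Y ⊗ E)) m n',
    carry_mass σ v m -> cup_mass v n' -> m <= r * n'.
Proof.
move=> bX nzX Fsimple dualF mF nF mn Y E v m n' mv nv.
have [l [G [j [sG jP]]]] := orthonormal_simples Y.
suff vP k : exists p : R[i] * R[i], [/\ carry_mass σ ((j k)^* ▷ E ∘ v) p.1,
    cup_mass ((j k)^* ▷ E ∘ v) p.2 & p.1 <= r * p.2].
  have {vP}/choice[p pP] := vP.
  have -> : m = \sum_k (p k).1.
    apply: (carry_mass_uniq nzX mv); apply: carry_mass_sum jP _ => k.
    by case: (pP k).
  have -> : n' = \sum_k (p k).2.
    apply: (cup_mass_uniq nv); apply: cup_mass_sum jP _ => k.
    by case: (pP k).
  by rewrite mulr_sumr; apply: ler_sum => k _; case: (pP k).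
set vk := _ ∘ v.
have [i [f [g [fK gK]]]] := Fsimple _ (sG k).
have [Z1 _] := (is_dualP _ _).1 (dualF i).
have bF : brick (F i).
  by apply: brick_iso (ufc_brick (sG k)); exists g, f.
have bD : brick (D i) by apply: dual_brick (dualF i) bF.
pose w := zag (ev i) (f ▷ E ∘ vk).
have vkE : vk = g ▷ E ∘ (F i ◁ w ∘ coev i).
  by rewrite zag_yank // mcompA -rw_comp fK tensm_id comp1m.
have [s s0 sE] := brick_norm g bF; have [t t0 tE] := brick_norm w bD.
exists (s * (t * m0 i), s * (t * n0 i)); rewrite vkE; split => /=.
- exact: carry_mass_factor.
- exact: cup_mass_factor.
rewrite [leRHS]mulrCA; apply: ler_wpM2l => //.
by rewrite [leRHS]mulrCA; apply: ler_wpM2l.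
Qed.

(** The order of [R[i]] is partial, but nonnegative elements are comparable. *)
Lemma max_attained n (r : 'I_n.+1 -> R[i]) :
  (forall k, 0 <= r k) -> exists k0, forall k, r k <= r k0.
Proof.
elim: n r => [|n IHn] r r0; first by exists ord0 => k; rewrite (ord1 k).
have [k1 k1P] := IHn (fun k => r (lift ord0 k)) (fun k => r0 _).
have /orP[le|le] := real_leVge (ger0_real (r0 ord0)) (ger0_real (r0 (lift ord0 k1))).
  by exists (lift ord0 k1) => k; case: (unliftP ord0 k) => [i|] ->.
exists ord0 => k; case: (unliftP ord0 k) => [i|] -> //.
exact: le_trans (k1P i) le.
Qed.

(** Let [r] be the largest ratio of the two masses among coevaluations of
    representatives of the simple objects; by [mass_bound] it bounds the ratio
    for every vector.  Nesting two copies of a coevaluation with ratio [r] gives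
    the ratio [r ^ 2], whence [r ^ 2 <= r] and [r <= 1]. *)
Lemma carry_mass_le X (σ : half_braiding M X) Y E (v : Mor C I (Y ⊗ E)) (m n' : R[i]) :
  brick X -> id_mor X != 0 -> carry_mass σ v m -> cup_mass v n' -> m <= n'.
Proof.
move=> bX nzX mv nv.
have [[|n] [F Fsimple]] := fusion_finite (ufc_fusion C).
  by have [[]] := Fsimple _ (fusion_unit_simple (ufc_fusion C)).
pose dual k := cid ((fusion_rigid (ufc_fusion C)).1 (F k)).
pose D k := sval (dual k).
pose ev k := sval (cid (svalP (dual k))).
pose coev k := sval (cid (svalP (cid (svalP (dual k))))).
have dualF k : is_dual (ev k) (coev k) by exact: (svalP (cid (svalP (cid (svalP (dual k)))))).
pose m0 k := s2val (cid2 (carry_mass_ex σ (coev k) bX)).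
pose n0 k := s2val (cid2 (cup_mass_ex (coev k))).
have m0P k : 0 <= m0 k by exact: (s2valP (cid2 (carry_mass_ex σ (coev k) bX))).
have mF k : carry_mass σ (coev k) (m0 k) by exact: (s2valP' (cid2 (carry_mass_ex σ (coev k) bX))).
have n0P k : 0 <= n0 k by exact: (s2valP (cid2 (cup_mass_ex (coev k)))).
have nF k : cup_mass (coev k) (n0 k) by exact: (s2valP' (cid2 (cup_mass_ex (coev k)))).
(* [F k] may be a zero object, and then both masses vanish. *)
have mn0 k : n0 k = 0 -> m0 k = 0.
  move=> n00; apply: (carry_mass_uniq nzX (mF k)) => A.
  rewrite carryE (@star_eq0 _ _ (cup (coev k) A)) ?nF ?n00 ?scale0r //.
  by rewrite tensm0r !compm0.
have r0 k : 0 <= m0 k / n0 k by rewrite divr_ge0.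
have [k0 k0P] := max_attained r0.
set r := m0 k0 / n0 k0 in k0P.
have mn k : m0 k <= r * n0 k.
  have [n00|nz] := eqVneq (n0 k) 0; first by rewrite mn0 // n00 mulr0.
  by rewrite -ler_pdivrMr ?k0P // lt0r nz n0P.
have bound := mass_bound bX nzX Fsimple dualF mF nF mn.
suff r1 : r <= 1.
  apply: le_trans (bound _ _ _ _ _ mv nv) _.
  have [n'' n''0 nv'] := cup_mass_ex v.
  by rewrite (cup_mass_uniq nv nv') ler_piMl.
have [n00|nz] := eqVneq (n0 k0) 0; first by rewrite /r n00 invr0 mulr0.
have mE : m0 k0 = r * n0 k0 by rewrite /r divfK.
have := bound _ _ _ _ _ (carry_mass_nest (mF k0) (mF k0)) (cup_mass_nest (nF k0) (nF k0)).
have [->//|rn0] := eqVneq r 0.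
have rgt0 : 0 < r by rewrite lt0r rn0 r0.
have npos : 0 < n0 k0 by rewrite lt0r nz n0P.
by rewrite mE mulrACA -mulrA ler_pM2l // -[leRHS]mul1r ler_pM2r // mulr_gt0.
Qed.

(** The half-braiding [σ] is compared with the adjoint [τ] of its inverse along a
    coevaluation.  The squared length of the difference is [m + m' - 2 n], where
    the masses [m] and [m'] after carrying along [σ] and [τ] are at most the
    mass [n] before; hence it vanishes. *)
Lemma hb_unitary X (σ : half_braiding M X) Y :
  simple_object X -> (hb σ Y)^* = hbV σ Y.
Proof.
move=> sX; have bX := ufc_brick sX; have nzX := simple_id_neq0 sX.
rewrite -(starK (cstar_star C) (hbV σ Y)); congr (_^*).
pose τ := adjoint_hb σ; rewrite -[(hbV σ Y)^*]/(hb τ Y).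
have [D [ev [v /is_dualP[Z1 _]]]] := (fusion_rigid (ufc_fusion C)).1 Y.
apply: (carry_inj Z1) => A; apply/subr0_eq/star_eq0.
have [m _ mv] := carry_mass_ex σ v bX; have [m' _ mv'] := carry_mass_ex τ v bX.
have [n n0 nv] := cup_mass_ex v.
have cross (s t : half_braiding M X) B : (hb s Y)^* ∘ hb t Y = id_mor _ ->
    (carry s v B)^* ∘ carry t v B = n *: id_mor (X ⊗ B).
  move=> K; rewrite !carryE star_comp star_act2 star_lw -!mcompA.
  rewrite (reassoc (esym (act2_comp _ _ _))) K act2_id comp1m -lw_comp nv.
  by rewrite tensmZr tensm_id.
have E B : (carry σ v B - carry τ v B)^* ∘ (carry σ v B - carry τ v B)
    = (m + m' - n - n) *: id_mor (X ⊗ B).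
  rewrite starD starN compDl !compDr !compNl !compNr mv mv'.
  have K : (hb σ Y)^* ∘ hb τ Y = id_mor _ by rewrite -star_comp hbK star_id.
  have K' : (hb τ Y)^* ∘ hb σ Y = id_mor _ by rewrite /= starK hbK.
  rewrite (cross _ _ _ K) (cross _ _ _ K') opprK -!scaleNr -!scalerDl.
  by congr (_ *: _); rewrite [- n + m']addrC addrA [m - n + m']addrAC.
have c0 : m + m' - n - n = 0.
  apply: le_anti; rewrite (star_ge0 (tens_unit_neq0 nzX) (E I)) andbT subr_le0.
  by rewrite lerBlDr lerD ?(carry_mass_le bX nzX mv nv) ?(carry_mass_le bX nzX mv' nv).
by rewrite E c0 scale0r.
Qed.

(** Both sides are natural, so they may be compared on the simple summands of
    [X]. *)
Lemma braid_unitary (c : braiding M) X Y : (c X Y)^* = braidV c X Y.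
Proof.
have [n [F [j [sF [_ _ jj]]]]] := orthonormal_simples X.
have nat k : c X Y ∘ (j k ▷ Y) = Y ◁ j k ∘ c (F k) Y by exact: braid_natural.
have natV k : (j k ▷ Y) ∘ braidV c (F k) Y = braidV c X Y ∘ Y ◁ j k.
  exact/esym/braidV_natural.
have natV' k : (c X Y)^* ∘ Y ◁ j k = (j k ▷ Y) ∘ (c (F k) Y)^*.
  have E : c (F k) Y ∘ (j k)^* ▷ Y = Y ◁ (j k)^* ∘ c X Y by exact: braid_natural.
  by rewrite -[j k](starK (cstar_star C)) -star_lw -star_comp -E star_comp star_rw.
rewrite -(compm1 (c X Y)^*) -(compm1 (braidV c X Y)) -tensm_id -jj tensm_sumr.
rewrite !comp_sumr; apply: eq_bigr => k _; rewrite lw_comp !mcompA natV' -natV.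
by rewrite (hb_unitary (braid_over c (F k)) Y (sF k)).
Qed.

(** * Twisted duals and uniqueness of the twist *)

Section Twists.
Variable c : braiding M.

(** The first equation of a unitary ribbon structure; the second one follows
    from it by [twisted_ev]. *)
Definition twisted_dual X D (ev : Mor C (D ⊗ X) I) (coev : Mor C I (X ⊗ D))
    (Θ : Mor C X X) : Prop :=
  is_dual ev coev /\ coev^* = ev ∘ c X D ∘ Θ ▷ D.

Lemma ev_slide X D (ev : Mor C (D ⊗ X) I) (coev : Mor C I (X ⊗ D)) (d : Mor C D D)
    (h : Mor C X X) :
  is_dual ev coev -> X ◁ d ∘ coev = h ▷ D ∘ coev -> ev ∘ d ▷ X = ev ∘ D ◁ h.
Proof.
move=> /is_dualP[Z1 Z2] E.
have -> : d = zag ev (X ◁ d ∘ coev) by rewrite zag_compl Z2 compm1.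
by rewrite zag_slide E zig_compl Z1 compm1.
Qed.

Lemma ev_braid_inj X D (ev : Mor C (D ⊗ X) I) (coev : Mor C I (X ⊗ D)) (f g : Mor C X X) :
  is_dual ev coev -> ev ∘ c X D ∘ f ▷ D = ev ∘ c X D ∘ g ▷ D -> f = g.
Proof.
move=> /is_dualP[Z1 _]; rewrite -!mcompA !braid_natural !mcompA => E.
have {}E := cancel_right (braidVK c X D) E.
by rewrite -(comp1m f) -(comp1m g) -Z1 -!zig_compr E.
Qed.

(** Since [h] commutes with the twist, it slides along the adjoint of [coev] to
    the same morphism as along [ev]: transposition commutes with adjoints. *)
Lemma twisted_slide X D (ev : Mor C (D ⊗ X) I) (coev : Mor C I (X ⊗ D)) (θ : Mor C X X)
    (d : Mor C D D) (h : Mor C X X) :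
  twisted_dual ev coev θ -> h ∘ θ = θ ∘ h -> X ◁ d ∘ coev = h ▷ D ∘ coev ->
  X ◁ d^* ∘ coev = h^* ▷ D ∘ coev.
Proof.
move=> [dD tw] hθ E; have evE := ev_slide dD E.
suff : coev^* ∘ X ◁ d = coev^* ∘ h ▷ D.
  by move/(congr1 (fun f => f^*)); rewrite !star_comp star_lw star_rw starK.
rewrite tw -!mcompA exchange (reassoc (braid_natural c _ _)) -mcompA.
rewrite (reassoc evE) -mcompA (reassoc (esym (braid_natural c _ _))) -mcompA.
by rewrite -!rw_comp hθ.
Qed.

(** With [d] for the positive morphism, [(d + 1) (d - 1) = 0], and [d + 1] is
    invertible because [-1] is not in the spectrum of [d]. *)
Lemma positive_involution X Y (b : Mor C X Y) :
  b^* ∘ b ∘ (b^* ∘ b) = id_mor X -> b^* ∘ b = id_mor X.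
Proof.
set d := b^* ∘ b => dd; have [_ sp] := cstar_positive b; rewrite -/d in sp.
have [g [gK _]] : is_iso (d - (-1) *: id_mor X).
  apply: contrapT => nI; have := sp (-1) nI.
  by rewrite oppr_ge0 ler10.
apply/subr0_eq; apply: (cancel_left gK).
rewrite compm0 scaleN1r opprK compDl !compDr !compNr comp1m !compm1 dd.
by rewrite addrA subrK subrr.
Qed.

(** The two duals are compared by an isomorphism [b] of the dual objects.  The
    transpose [h] of [b^* b] is the quotient of the two twists, hence unitary,
    and it is self-adjoint since [b^* b] is.  So [b^* b] is a positive
    involution and equals 1. *)
Lemma twisted_dual_unique X D D' (ev : Mor C (D ⊗ X) I) (coev : Mor C I (X ⊗ D))
    (ev' : Mor C (D' ⊗ X) I) (coev' : Mor C I (X ⊗ D')) (θ Θ : Mor C X X) :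
  twisted_dual ev coev θ -> twisted_dual ev' coev' Θ ->
  (forall f : Mor C X X, f ∘ θ = θ ∘ f) ->
  unitary (cstar_star C) θ -> unitary (cstar_star C) Θ -> Θ = θ.
Proof.
move=> tD [dD' tw'] cen [uθ uθ'] [uΘ uΘ']; have [dD tw] := tD.
have [Z1 Z2] := (is_dualP _ _).1 dD; have [Z1' Z2'] := (is_dualP _ _).1 dD'.
pose b := zag ev coev'; pose b' := zag ev' coev.
have bE : X ◁ b ∘ coev = coev' by apply: zag_yank.
have b'E : X ◁ b' ∘ coev' = coev by apply: zag_yank.
have evb : ev ∘ b' ▷ X = ev' by apply: zag_yank_ev.
have b'b : b' ∘ b = id_mor _ by rewrite /b -zag_compl b'E Z2.
pose d := b^* ∘ b; pose h := zig (X ◁ d ∘ coev) ev.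
have hE : X ◁ d ∘ coev = h ▷ D ∘ coev by rewrite zig_yank.
have ΘE : Θ = h ∘ θ.
  apply: (ev_braid_inj dD); transitivity (coev^* ∘ X ◁ d).
    have E : coev^* ∘ X ◁ b^* = coev'^* by rewrite -bE star_comp star_lw.
    rewrite lw_comp mcompA E tw' -evb -!mcompA exchange.
    rewrite (reassoc (esym (braid_natural c _ _))) -!mcompA.
    by rewrite (reassoc (esym (lw_comp _ _ _ _))) b'b tensm_id comp1m.
  rewrite tw -!mcompA exchange (reassoc (braid_natural c _ _)) -mcompA.
  rewrite (reassoc (ev_slide dD hE)) -mcompA (reassoc (esym (braid_natural c _ _))).
  by rewrite -mcompA -rw_comp.
have hh : h^* = h.
  have := twisted_slide tD (cen h) hE; rewrite star_comp starK -/d hE => E.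
  have := congr1 (fun ψ => zig ψ ev) E.
  by rewrite !zig_compl Z1 !compm1.
have h1 : h ∘ h = id_mor _.
  have hθ : h = Θ ∘ θ^* by rewrite ΘE -mcompA uθ compm1.
  rewrite -{1}hh hθ star_comp starK -!mcompA (reassoc uΘ') comp1m.
  exact: uθ.
have dd : d ∘ d = id_mor _.
  have E : X ◁ (d ∘ d) ∘ coev = coev.
    rewrite lw_comp -mcompA hE mcompA -exchange -mcompA hE mcompA -rw_comp h1.
    by rewrite tensm_id comp1m.
  by rewrite -[LHS]compm1 -Z2 -zag_compl E.
have d1 : d = id_mor _ by apply: positive_involution.
have h1' : h = id_mor _ by rewrite /h d1 tensm_id comp1m Z1.
by rewrite ΘE h1' comp1m.
Qed.

(** Both sides complete the adjoint of [coev] to a zigzag which is the identity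
    of [D]: the left one by duality, the right one by [braided_zig], after the
    two twists have cancelled. *)
Lemma twisted_ev X D (ev : Mor C (D ⊗ X) I) (coev : Mor C I (X ⊗ D)) (θ : Mor C X X) :
  twisted_dual ev coev θ -> unitary (cstar_star C) θ ->
  ev^* = D ◁ θ^* ∘ braidV c D X ∘ coev.
Proof.
move=> [dD tw] [uθ _].
have [_ Z2] := (is_dualP _ _).1 dD; have [_ Z2'] := (is_dualP _ _).1 (star_dual dD).
apply/esym; rewrite -mcompA.
have := zig_yank (D ◁ θ^* ∘ (braidV c D X ∘ coev)) Z2'.
rewrite zig_mid tw -mcompA -rw_comp uθ tensm_id compm1 braided_zig //.
by rewrite tensm_id comp1m.
Qed.

(** The twist equation is the adjoint of [twisted_ev], in which the twist has
    been slid to the strand [D] and the braiding is unitary. *)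
Lemma twisted_dual_star X D (ev : Mor C (D ⊗ X) I) (coev : Mor C I (X ⊗ D))
    (θ : Mor C X X) :
  twisted_dual ev coev θ -> unitary (cstar_star C) θ ->
  twisted_dual (coev^*) (ev^*) (zag ev (θ ▷ D ∘ coev)).
Proof.
move=> tD uθ; have [dD tw] := tD; split; first exact: star_dual.
have [Z1 _] := (is_dualP _ _).1 dD.
set τ := zag _ _.
have τE : X ◁ τ ∘ coev = θ ▷ D ∘ coev by apply: zag_yank.
have slide : coev^* ∘ X ◁ τ = coev^* ∘ θ ▷ D.
  have := twisted_slide tD erefl τE => /(congr1 (fun f => f^*)).
  by rewrite !star_comp star_lw star_rw !starK.
rewrite (twisted_ev tD uθ) !star_comp star_lw starK -(braid_unitary c D X) starK.
by rewrite -!mcompA !braid_natural !mcompA slide.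
Qed.

Lemma transpose_unitary X D (ev : Mor C (D ⊗ X) I) (coev : Mor C I (X ⊗ D))
    (θ : Mor C X X) :
  twisted_dual ev coev θ -> unitary (cstar_star C) θ ->
  unitary (cstar_star C) (zag ev (θ ▷ D ∘ coev)).
Proof.
move=> tD [uθ uθ']; have [dD tw] := tD; have [Z1 Z2] := (is_dualP _ _).1 dD.
set τ := zag _ _.
have τE : X ◁ τ ∘ coev = θ ▷ D ∘ coev by apply: zag_yank.
have τE' := twisted_slide tD erefl τE.
split; rewrite -[LHS]compm1 -Z2 -zag_compl lw_comp -mcompA.
  rewrite τE' mcompA -exchange -mcompA τE mcompA -rw_comp uθ'.
  by rewrite tensm_id comp1m.
rewrite τE mcompA -exchange -mcompA τE' mcompA -rw_comp uθ.
by rewrite tensm_id comp1m.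
Qed.

(** By uniqueness of the twist, this becomes the twist axiom; the double braiding
    comes from [nest_ev_braid]. *)
Lemma nested_twisted_dual X Y D E (ev : Mor C (D ⊗ X) I) (coev : Mor C I (X ⊗ D))
    (ev' : Mor C (E ⊗ Y) I) (coev' : Mor C I (Y ⊗ E)) (θ : Mor C X X) (θ' : Mor C Y Y) :
  twisted_dual ev coev θ -> twisted_dual ev' coev' θ' ->
  twisted_dual (nest_ev ev ev') (nest_coev coev coev') ((θ ⊗₁ θ') ∘ c Y X ∘ c X Y).
Proof.
move=> [dD tw] [dE tw']; split; first exact: nested_dual.
rewrite /nest_coev !star_comp star_assocV star_lw star_cup mcompA -/(nest_ev _ _).
rewrite tw tw' nest_ev_comp nest_ev_braid -!mcompA -rw_comp.
by rewrite -mcompA (braid_natural c θ θ') (reassoc (braid_natural c _ _)) -mcompA.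
Qed.

(** * Phases of simple objects *)

Lemma dual_scale X D (ev : Mor C (D ⊗ X) I) (coev : Mor C I (X ⊗ D)) (a : R[i]) :
  a != 0 -> is_dual ev coev -> is_dual (a *: ev) (a^-1 *: coev).
Proof.
move=> a0 /is_dualP[Z1 Z2]; apply/is_dualP; split.
  have -> : a *: ev = ev ∘ D ◁ (a *: id_mor X).
    by rewrite tensmZr tensm_id compZr compm1.
  have -> : a^-1 *: coev = (a^-1 *: id_mor X) ▷ D ∘ coev.
    by rewrite tensmZl tensm_id compZl comp1m.
  by rewrite zig_compr zig_compl Z1 compm1 compZl comp1m scalerA mulVf // scale1r.
have -> : a *: ev = ev ∘ (a *: id_mor D) ▷ X.
  by rewrite tensmZl tensm_id compZr compm1.
have -> : a^-1 *: coev = X ◁ (a^-1 *: id_mor D) ∘ coev.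
  by rewrite tensmZr tensm_id compZl comp1m.
by rewrite zag_compr zag_compl Z2 compm1 compZl comp1m scalerA mulVf // scale1r.
Qed.

(** By [twisted_dual_unique], the phase of the twist on [X] is forced to be [z]. *)
Definition scalar_twist X (z : R[i]) : Prop :=
  `|z| = 1 /\ exists D (ev : Mor C (D ⊗ X) I) (coev : Mor C I (X ⊗ D)),
    twisted_dual ev coev (z *: id_mor X).

(** For any dual the twist equation holds up to a scalar [w], and rescaling the
    dual by the square root of [`|w|] makes it a phase. *)
Lemma scalar_twist_ex X : simple_object X -> exists z, scalar_twist X z.
Proof.
move=> sX; have nzX := simple_id_neq0 sX.
have [D [ev [coev dD]]] := (fusion_rigid (ufc_fusion C)).1 X.
have [Z1 Z2] := (is_dualP _ _).1 dD.
have := zig_yank_ev (coev^* ∘ braidV c X D) Z2.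
have [w ->] := ufc_brick sX (zig coev (coev^* ∘ braidV c X D)).
rewrite tensmZr tensm_id compZr compm1 => /(congr1 (fun f => f ∘ c X D)).
rewrite -mcompA braidK compm1 compZl => /esym wE.
have w0 : w != 0.
  apply/eqP => w0; case/eqP: nzX; rewrite -Z1 -(starK (cstar_star C) coev) wE w0.
  by rewrite scale0r star0 zig0l.
have nw0 : `|w| != 0 by rewrite normr_eq0.
have sw0 : sqrtC `|w| != 0 by rewrite sqrtC_eq0.
have csw : Num.conj (sqrtC `|w|)^-1 = (sqrtC `|w|)^-1.
  by rewrite geC0_conj // invr_ge0 sqrtC_ge0.
exists (w / `|w|); split; first by rewrite normrM normfV normr_id divff.
exists D, (sqrtC `|w| *: ev), ((sqrtC `|w|)^-1 *: coev); split.
  exact: dual_scale.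
rewrite starZ csw wE tensmZl tensm_id !compZl compZr compm1 !scalerA.
congr (_ *: _); apply: (mulfI sw0).
by rewrite mulVKf // [RHS]mulrA -expr2 sqrtCK mulrC divfK.
Qed.

Lemma twisted_dual_transport X Y D (ev : Mor C (D ⊗ X) I) (coev : Mor C I (X ⊗ D))
    (θ : Mor C X X) (u : Mor C X Y) :
  unitary (cstar_star C) u -> twisted_dual ev coev θ ->
  twisted_dual (ev ∘ D ◁ u^*) (u ▷ D ∘ coev) (u ∘ θ ∘ u^*).
Proof.
move=> [uu uu'] [/is_dualP[Z1 Z2] tw]; split.
  apply/is_dualP; split; first by rewrite zig_compl zig_compr Z1 comp1m uu.
  by rewrite zag_mid mcompA -rw_comp uu' tensm_id comp1m.
rewrite star_comp star_rw tw -!mcompA (reassoc (esym (braid_natural c _ _))) -!mcompA.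
by rewrite -!rw_comp (reassoc uu') comp1m.
Qed.

(** [f] is a positive multiple of a unitary, along which a twisted dual of [X] is
    transported to [Y], where the phase is unique. *)
Lemma scalar_twist_eq X Y z z' (f : Mor C X Y) :
  simple_object X -> simple_object Y -> scalar_twist X z -> scalar_twist Y z' ->
  f != 0 -> z = z'.
Proof.
move=> sX sY [z1 [D [ev [coev tD]]]] [z1' [D' [ev' [coev' tD']]]] f0.
have [s s0 sE] := brick_norm f (ufc_brick sX).
have [s' s0' sE'] := brick_norm (f^*) (ufc_brick sY); rewrite starK in sE'.
have ss : s = s'.
  have : s *: f = s' *: f.
    by rewrite -[f in LHS]compm1 -compZr -sE mcompA sE' compZl comp1m.
  move/eqP; rewrite -subr_eq0 -scalerBl scaler_eq0 (negPf f0) orbF subr_eq0.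
  by move/eqP.
have snz : s != 0.
  by apply: contra f0 => /eqP s00; rewrite (@star_eq0 _ _ f) // sE s00 scale0r.
pose u := (sqrtC s)^-1 *: f.
have cs : Num.conj (sqrtC s)^-1 = (sqrtC s)^-1.
  by rewrite geC0_conj // invr_ge0 sqrtC_ge0.
have us : unitary (cstar_star C) u.
  split; rewrite /u starZ cs compZl compZr ?sE' ?sE -?ss !scalerA -expr2 exprVn.
    by rewrite sqrtCK mulVf // scale1r.
  by rewrite sqrtCK mulVf // scale1r.
have zu Z (t : R[i]) : `|t| = 1 -> unitary (cstar_star C) (t *: id_mor Z).
  move=> t1; rewrite /unitary starZ star_id compZl compZr compm1 scalerA.
  by rewrite -normCK t1 expr1n scale1r compZl compZr compm1 scalerA mulrC -normCK t1 expr1n scale1r.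
have tY := twisted_dual_transport us tD.
have uE : u ∘ (z *: id_mor X) ∘ u^* = z *: id_mor Y.
  by rewrite compZr compm1 compZl us.1.
rewrite uE in tY; apply: (scale_id_inj (simple_id_neq0 sY)).
apply: (twisted_dual_unique tD' tY); [move=> g | exact: zu | exact: zu].
by rewrite compZr compm1 compZl comp1m.
Qed.

(** * The canonical twist *)

Lemma dual_neq0 X D (ev : Mor C (D ⊗ X) I) (coev : Mor C I (X ⊗ D)) :
  is_dual ev coev -> id_mor X != 0 -> id_mor D != 0.
Proof.
move=> /is_dualP[Z1 _]; apply: contra => /eqP D0; apply/eqP; rewrite -Z1.
by rewrite -(compm1 ev) -tensm_id D0 tensm0l compm0 zig0r.
Qed.

(** Duals are assembled from those of the summands on an orthogonal direct sum
    of the dual objects; orthogonality makes adjoints compatible with the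
    decomposition. *)
Lemma twisted_dual_sum n (F : 'I_n -> C) X (j : forall k, Mor C (F k) X)
    (z : 'I_n -> R[i]) :
  (forall k, simple_object (F k)) -> direct_sum j (fun k => (j k)^*) ->
  (forall k, scalar_twist (F k) (z k)) ->
  exists D (ev : Mor C (D ⊗ X) I) (coev : Mor C I (X ⊗ D)),
    twisted_dual ev coev (\sum_k z k *: (j k ∘ (j k)^*)).
Proof.
move=> sF [jj jj0 j1] tF.
pose D k := sval (cid (tF k).2).
pose ev k := sval (cid (svalP (cid (tF k).2))).
pose coev k := sval (cid (svalP (cid (svalP (cid (tF k).2))))).
have dF k : twisted_dual (ev k) (coev k) (z k *: id_mor (F k)).
  exact: (svalP (cid (svalP (cid (svalP (cid (tF k).2)))))).
have bD k : brick (D k) by apply: dual_brick (dF k).1 (ufc_brick (sF k)).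
have nzD k : id_mor (D k) != 0.
  by apply: dual_neq0 (dF k).1 (simple_id_neq0 (sF k)).
have [DX [i [p ds]]] := has_direct_sums (fusion_abelian (ufc_fusion C)) D.
have [q [qq qq0 q1]] := orthonormalize bD nzD ds.
exists DX, (\sum_k ev k ∘ ((q k)^* ⊗₁ (j k)^*)), (\sum_k (j k ⊗₁ q k) ∘ coev k).
have evE k : ev k ∘ ((q k)^* ⊗₁ (j k)^*) = ev k ∘ (q k)^* ▷ F k ∘ DX ◁ (j k)^*.
  by rewrite tensmE mcompA.
have evE' k : ev k ∘ ((q k)^* ⊗₁ (j k)^*) = ev k ∘ D k ◁ (j k)^* ∘ (q k)^* ▷ X.
  by rewrite tensmE exchange mcompA.
have coevE k : (j k ⊗₁ q k) ∘ coev k = j k ▷ DX ∘ (F k ◁ q k ∘ coev k).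
  by rewrite tensmE mcompA.
have coevE' k : (j k ⊗₁ q k) ∘ coev k = X ◁ q k ∘ (j k ▷ D k ∘ coev k).
  by rewrite tensmE exchange mcompA.
split.
  apply/is_dualP; split.
    rewrite zig_suml -j1; apply: eq_bigr => k _; rewrite zig_sumr (bigD1 k) //=.
    rewrite big1 ?addr0 => [|l lk]; rewrite coevE evE zig_compl zig_compr zig_mid.
      rewrite -!mcompA -rw_comp qq tensm_id compm1.
      by have [/is_dualP[-> _] _] := dF k; rewrite comp1m.
    by rewrite -!mcompA -rw_comp qq0 // tensm0l compm0 zig0r comp0m compm0.
  rewrite zag_sumr -q1; apply: eq_bigr => k _; rewrite zag_suml (bigD1 k) //=.
  rewrite big1 ?addr0 => [|l lk]; rewrite coevE' evE' zag_compl zag_compr zag_mid.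
    rewrite (reassoc (esym (rw_comp _ _ _ _))) jj tensm_id comp1m.
    by have [/is_dualP[_ ->] _] := dF k; rewrite comp1m.
  by rewrite (reassoc (esym (rw_comp _ _ _ _))) jj0 // tensm0l comp0m zag0r comp0m compm0.
set Θ := \sum_k z k *: _.
have jΘ k : (j k)^* ∘ Θ = z k *: (j k)^*.
  rewrite comp_sumr (bigD1 k) //= big1 ?addr0 => [|l lk]; rewrite compZr mcompA.
    by rewrite jj comp1m.
  by rewrite jj0 ?comp0m ?scaler0 // eq_sym.
have qΘ k : ((q k)^* ⊗₁ (j k)^*) ∘ DX ◁ Θ = z k *: ((q k)^* ⊗₁ (j k)^*).
  by rewrite -tensm_comp compm1 jΘ tensmZr.
rewrite -mcompA braid_natural mcompA !comp_suml star_sum; apply: eq_bigr => k _.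
rewrite star_comp ufc_star_tensm (dF k).2 -!mcompA (reassoc (qΘ k)).
rewrite tensmZl tensm_id !compZl comp1m !compZr; congr (_ *: (_ ∘ _)).
exact: braid_natural.
Qed.

(** The decomposition and the phases are merely required to exist;
    [diagonal_twist_natural] shows that [Θ] does not depend on them. *)
Definition diagonal_twist X (Θ : Mor C X X) : Prop :=
  exists n (F : 'I_n -> C) (j : forall k, Mor C (F k) X) (z : 'I_n -> R[i]),
    [/\ forall k, simple_object (F k), direct_sum j (fun k => (j k)^*),
        forall k, scalar_twist (F k) (z k)
      & Θ = \sum_k z k *: (j k ∘ (j k)^*)].

Lemma diagonal_twist_ex X : exists Θ : Mor C X X, diagonal_twist Θ.
Proof.
have [n [F [j [sF jP]]]] := orthonormal_simples X.
have /choice[z zP] : forall k, exists z, scalar_twist (F k) z.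
  by move=> k; apply: scalar_twist_ex.
by eexists; exists n, F, j, z; split.
Qed.

(** Between two simple summands, a nonzero component of [f] forces the phases to
    agree. *)
Lemma diagonal_twist_natural X Y (Θ : Mor C X X) (Θ' : Mor C Y Y) (f : Mor C X Y) :
  diagonal_twist Θ -> diagonal_twist Θ' -> f ∘ Θ = Θ' ∘ f.
Proof.
move=> [n [F [j [z [sF [jj jj0 j1] tF ->]]]]] [m [G [i [w [sG [ii ii0 i1] tG ->]]]]].
set Ψ := \sum_k w k *: _.
have step k : Ψ ∘ (f ∘ j k) = z k *: (f ∘ j k).
  rewrite -[f ∘ j k in RHS]comp1m -i1 !comp_suml scaler_sumr.
  apply: eq_bigr => l _; rewrite compZl -mcompA.
  have [->|nz] := eqVneq ((i l)^* ∘ (f ∘ j k)) 0; first by rewrite compm0 !scaler0.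
  by rewrite (scalar_twist_eq (sF k) (sG l) (tF k) (tG l) nz).
rewrite -[RHS]compm1 -j1 !comp_sumr; apply: eq_bigr => k _.
by rewrite compZr !mcompA -(mcompA Ψ) step compZl.
Qed.

Lemma diagonal_twist_unitary X (Θ : Mor C X X) :
  diagonal_twist Θ -> unitary (cstar_star C) Θ.
Proof.
move=> [n [F [j [z [sF [jj jj0 j1] tF ->]]]]].
have zz k : z k * Num.conj (z k) = 1 by rewrite -normCK (tF k).1 expr1n.
have E (a b : 'I_n -> R[i]) : (forall k, a k * b k = 1) ->
    (\sum_k a k *: (j k ∘ (j k)^*)) ∘ (\sum_k b k *: (j k ∘ (j k)^*)) = id_mor X.
  move=> ab; rewrite comp_suml -j1; apply: eq_bigr => k _.
  rewrite comp_sumr (bigD1 k) //= big1 ?addr0 => [|l lk].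
    rewrite compZl compZr scalerA ab scale1r -mcompA (reassoc (jj k)).
    by rewrite comp1m.
  by rewrite compZl compZr -mcompA (reassoc (jj0 _ _ _)) 1?eq_sym // comp0m compm0 !scaler0.
have starE : (\sum_k z k *: (j k ∘ (j k)^*))^*
    = \sum_k Num.conj (z k) *: (j k ∘ (j k)^*).
  by rewrite star_sum; apply: eq_bigr => k _; rewrite starZ star_comp starK.
by split; rewrite starE E // => k; rewrite mulrC.
Qed.

Lemma diagonal_twist_dual X (Θ : Mor C X X) : diagonal_twist Θ ->
  exists D (ev : Mor C (D ⊗ X) I) (coev : Mor C I (X ⊗ D)), twisted_dual ev coev Θ.
Proof. by move=> [n [F [j [z [sF jP tF ->]]]]]; apply: twisted_dual_sum. Qed.

Lemma diagonal_twist_central X (Θ : Mor C X X) (f : Mor C X X) :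
  diagonal_twist Θ -> f ∘ Θ = Θ ∘ f.
Proof. by move=> dΘ; apply: diagonal_twist_natural. Qed.

Lemma diagonal_twist_unique X D (ev : Mor C (D ⊗ X) I) (coev : Mor C I (X ⊗ D))
    (Θ Θ' : Mor C X X) :
  diagonal_twist Θ -> twisted_dual ev coev Θ' -> unitary (cstar_star C) Θ' -> Θ' = Θ.
Proof.
move=> dΘ tD uΘ'; have [D' [ev' [coev' tD']]] := diagonal_twist_dual dΘ.
apply: (twisted_dual_unique tD' tD) => //; last exact: diagonal_twist_unitary.
by move=> f; apply: diagonal_twist_central.
Qed.

Definition canonical_twist_mor X : Mor C X X := sval (cid (diagonal_twist_ex X)).

Lemma canonical_twistP X : diagonal_twist (canonical_twist_mor X).
Proof. exact: (svalP (cid (diagonal_twist_ex X))). Qed.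

Definition canonical_twist : id_automorphism C.
Proof.
exists canonical_twist_mor (fun X => (canonical_twist_mor X)^*) => [X|X Y f].
  by have [] := diagonal_twist_unitary (canonical_twistP X).
exact: diagonal_twist_natural (canonical_twistP X) (canonical_twistP Y).
Defined.

Lemma canonical_twist_twist : twist c canonical_twist.
Proof.
move=> X Y; have [D [ev [coev tD]]] := diagonal_twist_dual (canonical_twistP X).
have [E [ev' [coev' tE]]] := diagonal_twist_dual (canonical_twistP Y).
have [uX uX'] := diagonal_twist_unitary (canonical_twistP X).
have [uY uY'] := diagonal_twist_unitary (canonical_twistP Y).
apply/esym/(diagonal_twist_unique (canonical_twistP _) (nested_twisted_dual tD tE)).
split; rewrite !star_comp ufc_star_tensm !braid_unitary -!mcompA.
  rewrite (reassoc (braidVK c _ _)) comp1m (reassoc (braidVK c _ _)) comp1m.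
  by rewrite -tensm_comp uX uY tensm_id.
rewrite (reassoc (esym (tensm_comp _ _ _ _ _))) uX' uY' tensm_id comp1m.
by rewrite (reassoc (braidK c _ _)) comp1m braidK.
Qed.

(** For a twisted dual, the transpose of the twist is a unitary with a twisted
    dual of [D], hence the twist of [D].  Any other dual object is related to [D]
    by an isomorphism [b], with which the twist commutes. *)
Lemma canonical_twist_ribbon : ribbon c canonical_twist.
Proof.
split; first exact: canonical_twist_twist.
move=> X D' ev' coev' /is_dualP[Z1' Z2'].
have [D [ev [coev tD]]] := diagonal_twist_dual (canonical_twistP X).
have [Z1 Z2] := (is_dualP _ _).1 tD.1.
have uX := diagonal_twist_unitary (canonical_twistP X).
have τE := diagonal_twist_unique (canonical_twistP D) (twisted_dual_star tD uX)
  (transpose_unitary tD uX).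
rewrite transposeE; pose b := zag ev coev'; pose b' := zag ev' coev.
have bE : X ◁ b ∘ coev = coev' by apply: zag_yank.
have evb : ev ∘ b' ▷ X = ev' by apply: zag_yank_ev.
have bb' : b ∘ b' = id_mor _ by rewrite /b -zag_compr evb Z2'.
rewrite -bE mcompA exchange -mcompA -evb zag_compl zag_compr.
rewrite [zag ev _]τE mcompA.
have := theta_natural canonical_twist b; rewrite /= => ->.
by rewrite -mcompA bb' compm1.
Qed.

Lemma canonical_twist_unitary_ribbon : unitary_ribbon c canonical_twist.
Proof.
have uX X := diagonal_twist_unitary (canonical_twistP X).
split=> [|//|X]; first exact: canonical_twist_ribbon.
have [D [ev [coev tD]]] := diagonal_twist_dual (canonical_twistP X).
exists D, ev, coev; split; [exact: tD.1 | exact: tD.2 | exact: twisted_ev tD (uX X)].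
Qed.

Lemma unitary_ribbon_unique (θ : id_automorphism C) :
  unitary_ribbon c θ -> canonical_twist = θ.
Proof.
move=> [_ uθ dθ].
have E : theta canonical_twist = theta θ.
  apply: functional_extensionality_dep => X.
  have [D [ev [coev [dD tw _]]]] := dθ X.
  exact/esym/(diagonal_twist_unique (canonical_twistP X) (conj dD tw)).
have EV : thetaV canonical_twist = thetaV θ.
  apply: functional_extensionality_dep => X.
  have [K _] := theta_inverse canonical_twist X.
  have [_ K'] := theta_inverse θ X.
  by apply: inverse_unique K _; rewrite E.
case: θ canonical_twist E EV {uθ dθ} => t tV tI tN [s sV sI sN] /= E EV.
case: _ / E in tI tN *; case: _ / EV in tI *.
by rewrite (Prop_irrelevance sI tI) (Prop_irrelevance sN tN).
Qed.

End Twists.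
End Unitary.

Theorem theorem3p5 (R : realType) (C : unitary_fusion_category R)
    (c : braiding (ufc_monoidal C)) :
  exists! theta : id_automorphism C, unitary_ribbon c theta.
Proof.
exists (canonical_twist c); split; first exact: canonical_twist_unitary_ribbon.
exact: unitary_ribbon_unique.
Qed.
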